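(* Let $M$ be an oriented matroid on a ground set $E$. Let $\sigma$ be the generic circuit signature of $M$ induced by a generic single-element lifting $\widetilde M$ of $M$, and let $\sigma^*$ be the generic cocircuit signature of $M$ induced by a generic single-element extension $M'$ of $M$. For a basis $B$ of $M$, let $\mathcal O(B)$ be the orientation of $M$ in which each $e\notin B$ is oriented according to its sign in the signed circuit $\sigma(C(B,e))$ and each $e\in B$ is oriented according to its sign in the signed cocircuit $\sigma^*(C^*(B,e))$. Then the map $\beta_{\sigma,\sigma^*}: B\mapsto \mathcal O(B)$ is a bijection between the set of bases of $M$ and the set of $(\sigma,\sigma^* )$-compatible orientations of $M$.
   Context: Oriented matroids are finite. For a signed set $X$, $\underline X$ denotes its support. ''Circuit'' and ''cocircuit'' without the word ''signed'' refer to the underlying matroid. For a basis $B$: if $e\notin B$, $C(B,e)$ is the fundamental circuit, i.e. the unique circuit contained in $B\cup e$; if $e\in B$, $C^*(B,e)$ is the fundamental cocircuit, i.e. the unique cocircuit disjoint from $B\setminus e$. Let $M$ have rank $r$. A single-element extension of $M$ is an oriented matroid $M'$ of rank $r$ on $E\sqcup\{f\}$ with $M=M'\setminus f$; it is generic if every circuit of $M'$ containing $f$ is spanning. A single-element lifting of $M$ is an oriented matroid $\widetilde M$ of rank $r+1$ on $E\sqcup\{g\}$ with $M=\widetilde M/g$; it is generic if every cocircuit of $\widetilde M$ containing $g$ has independent complement. A cocircuit signature of $M$ is a map $\sigma^*$ from the signed cocircuits of $M$ to $\{+,-,0\}$ with $\sigma^*(-D)=-\sigma^*(D)$; it is generic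 if it never takes the value $0$. Circuit signatures $\sigma$ are defined analogously on signed circuits. An extension $M'$ induces the cocircuit signature $\sigma^*(D):=D'(f)$, where $D'$ is the unique signed cocircuit of $M'$ with $D'|_E=D$. A lifting $\widetilde M$ induces the circuit signature $\sigma(C):=\widetilde C(g)$, where $\widetilde C$ is the unique signed circuit of $\widetilde M$ with $\widetilde C|_E=C$. Signatures induced by generic extensions/liftings are generic. For a generic signature and an unsigned circuit $\underline C$ (resp. cocircuit $\underline D$), $\sigma(\underline C)$ (resp. $\sigma^*(\underline D)$) denotes the one of the two signed circuits (resp. cocircuits) with that support on which the signature is $+$. An orientation of $M$ is a map $\mathcal O:E\to\{+,-\}$. It is conformal with a signed circuit or cocircuit $C$ if $\mathcal O(e)=C(e)$ for all $e\in\underline C$. It is $\sigma$-compatible (resp. $\sigma^*$-compatible) if $\sigma$ (resp. $\sigma^*$) is $+$ on every signed circuit (resp. cocircuit) conformal with $\mathcal O$, and $(\sigma,\sigma^* )$-compatible if both hold. *)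

(* Defs.v *)
From mathcomp Require Import all_boot.

Set Implicit Arguments.
Unset Strict Implicit.
Unset Printing Implicit Defensive.

(* The signs {+,-,0} are encoded in [option bool], with
   + = Some true, - = Some false and 0 = None. *)
Notation sign := (option bool).
Notation Pos := (Some true) (only parsing).
Notation Neg := (Some false) (only parsing).
Notation Zero := (@None bool) (only parsing).

Notation signed_set E := {ffun E -> sign}.

Section SignedSets.
Variable E : finType.
Implicit Types X Y : signed_set E.

Definition zero_set : signed_set E := [ffun=> Zero].
Definition opp X : signed_set E := [ffun e => omap negb (X e)].
Definition pos_part X : {set E} := [set e | X e == Pos].
Definition neg_part X : {set E} := [set e | X e == Neg].
Definition supp X : {set E} := [set e | X e != Zero].

Definition orthogonal X Y : bool :=
  [disjoint supp X & supp Y] ||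
  [exists e in supp X, X e == Y e] && [exists e in supp X, X e == opp Y e].

End SignedSets.

(* Signed circuit axioms, with weak elimination. *)
Record oriented_matroid (E : finType) := OrientedMatroid {
  scircuits : {set signed_set E};
  scircuits_nonzero : zero_set E \notin scircuits;
  scircuits_opp : forall X, X \in scircuits -> opp X \in scircuits;
  scircuits_incomparable : forall X Y,
    X \in scircuits -> Y \in scircuits -> supp X \subset supp Y ->
    X = Y \/ X = opp Y;
  scircuits_elimination : forall X Y e,
    X \in scircuits -> Y \in scircuits -> X <> opp Y ->
    e \in pos_part X -> e \in neg_part Y ->
    exists Z, [/\ Z \in scircuits,
      pos_part Z \subset (pos_part X :|: pos_part Y) :\ e &
      neg_part Z \subset (neg_part X :|: neg_part Y) :\ e]
}.

Section Matroid.
Variables (E : finType) (M : oriented_matroid E).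
Implicit Types A B D : {set E}.

Definition circuits : {set {set E}} := [set supp X | X in scircuits M].

Definition indep A : bool := [forall C in circuits, ~~ (C \subset A)].

Definition bases : {set {set E}} := [set B | maxset indep B].

Definition rank A : nat := \max_(I : {set E} | (I \subset A) && indep I) #|I|.

Definition spanning A : bool := rank A == rank [set: E].

(* Circuits of the dual matroid, whose bases are the complements of bases. *)
Definition cocircuits : {set {set E}} :=
  [set D | minset (fun A => ~~ [exists B in bases, A \subset ~: B]) D].

(* Signed circuits of the dual oriented matroid: the signature of the
   cocircuits that is orthogonal to the signed circuits. *)
Definition scocircuits : {set signed_set E} :=
  [set D | (supp D \in cocircuits) &&
           [forall X in scircuits M, orthogonal X D]].

(* The defaults set0 below are unused for B a basis and e \notin B, resp.
   e \in B. *)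
Definition fund_circuit B (e : E) : {set E} :=
  odflt set0 [pick C in circuits | C \subset e |: B].

Definition fund_cocircuit B (e : E) : {set E} :=
  odflt set0 [pick D in cocircuits | [disjoint D & B :\ e]].

End Matroid.

(* One-element deletion and contraction.  The ground set E with one element
   added is [option E], and the added element is [None]. *)
Section Minors.
Variables (E : finType) (N : oriented_matroid (option E)).

Definition restr (X : signed_set (option E)) : signed_set E :=
  [ffun e => X (Some e)].

Definition deletion_scircuits : {set signed_set E} :=
  [set restr X | X in scircuits N & X None == Zero].

(* Nonzero restrictions of signed circuits, of minimal support. *)
Definition contraction_scircuits : {set signed_set E} :=
  let R := [set restr X | X in scircuits N] :\ zero_set E in
  [set X in R | minset (fun A => A \in [set supp Y | Y in R]) (supp X)].

End Minors.

Section ExtensionLifting.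
Variables (E : finType) (M : oriented_matroid E).
Variable N : oriented_matroid (option E).

Definition is_extension : Prop :=
  rank N [set: option E] = rank M [set: E] /\
  scircuits M = deletion_scircuits N.

Definition generic_extension : Prop :=
  is_extension /\
  forall C : {set option E}, C \in circuits N -> None \in C -> spanning N C.

Definition is_lifting : Prop :=
  rank N [set: option E] = (rank M [set: E]).+1 /\
  scircuits M = contraction_scircuits N.

Definition generic_lifting : Prop :=
  is_lifting /\
  forall D : {set option E}, D \in cocircuits N -> None \in D -> indep N (~: D).

End ExtensionLifting.

(* Circuit (resp. cocircuit) signatures are total functions on signed sets, of
   which only the values on signed circuits (resp. cocircuits) are used. *)
Notation signature E := (signed_set E -> sign).

(* C |-> C'(None), for the unique signed circuit C' of N with restriction C *)
Definition lifting_signature (E : finType) (N : oriented_matroid (option E)) :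
    signature E :=
  fun C => if [pick C' in scircuits N | restr C' == C] is Some C'
           then C' None else Zero.

Definition extension_signature (E : finType) (N : oriented_matroid (option E)) :
    signature E :=
  fun D => if [pick D' in scocircuits N | restr D' == D] is Some D'
           then D' None else Zero.

Section Compatibility.
Variables (E : finType) (M : oriented_matroid E).
Variables (sigma sigma_star : signature E).

(* sigma(C) and sigma^*(D) for an unsigned circuit C and cocircuit D; the
   default [zero_set] is unused when the signatures are generic. *)
Definition signed_circuit_of (C : {set E}) : signed_set E :=
  odflt (zero_set E)
    [pick X in scircuits M | (supp X == C) && (sigma X == Pos)].

Definition signed_cocircuit_of (D : {set E}) : signed_set E :=
  odflt (zero_set E)
    [pick X in scocircuits M | (supp X == D) && (sigma_star X == Pos)].

(* Orientations are the signed sets that nowhere take the value 0. *)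
Definition orientation (O : signed_set E) : bool := [forall e, O e != Zero].

Definition conformal (O X : signed_set E) : bool :=
  [forall e in supp X, O e == X e].

Definition sigma_compatible (O : signed_set E) : bool :=
  [forall X in scircuits M, conformal O X ==> (sigma X == Pos)].

Definition sigma_star_compatible (O : signed_set E) : bool :=
  [forall X in scocircuits M, conformal O X ==> (sigma_star X == Pos)].

Definition compatible_orientations : {set signed_set E} :=
  [set O | [&& orientation O, sigma_compatible O & sigma_star_compatible O]].

Definition beta (B : {set E}) : signed_set E :=
  [ffun e => if e \in B then signed_cocircuit_of (fund_cocircuit M B e) e
             else signed_circuit_of (fund_circuit M B e) e].

End Compatibility.

(* Main.v *)
Require Import Defs.
From mathcomp Require Import all_boot.

(** Write [O] for the image of a basis [B], and let [f] and [g] be the elements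
    added by the extension and by the lifting.  By genericity the extension has
    a signed circuit with support [B + f], negative at [f], and the lifting has
    a signed cocircuit with support [(E - B) + g], negative at [g]; together
    they agree with [O] on all of [E].  Orthogonality to them makes [O]
    compatible.  If two bases [B1], [B2] have the same image, eliminate [f]
    between the circuit of [B1] and the opposite of that of [B2], and lift the
    resulting circuit of [M]: whatever its sign at [g] is, it fails to be
    orthogonal to the cocircuit of [B1] or to that of [B2].

    Surjectivity follows by counting.  In a partial orientation every element is
    oriented, deleted or contracted.  When one more element is no longer
    oriented but is deleted or contracted instead, the number of compatible
    partial orientations does not decrease: this only uses the orthogonality of
    circuits and cocircuits.  At the end, the contracted elements form a basis.

    That every cocircuit carries a signature orthogonal to the circuits is shown
    by contracting a basis, one element at a time, down to rank one. *)

Set Implicit Arguments.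
Unset Strict Implicit.
Unset Printing Implicit Defensive.

(** * Signed sets and signed circuits *)

Section SignedSetLemmas.
Variable E : finType.
Implicit Types (X Y Z D : signed_set E) (a b e h : E).

Lemma oppE X e : opp X e = omap negb (X e).
Proof. by rewrite ffunE. Qed.

Lemma opp_eq0 X e : (opp X e == None) = (X e == None).
Proof. by rewrite oppE; case: (X e). Qed.

Lemma oppK : involutive (@opp E).
Proof. by move=> X; apply/ffunP=> e; rewrite !oppE; case: (X e) => [[]|]. Qed.

Lemma supp_opp X : supp (opp X) = supp X.
Proof. by apply/setP=> e; rewrite !inE opp_eq0. Qed.

Lemma orthogonal_oppr X Y : orthogonal X (opp Y) = orthogonal X Y.
Proof.
rewrite /orthogonal supp_opp; congr (_ || _).
rewrite andbC; congr (_ && _); apply: eq_existsb => e; rewrite !oppE;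
  by case: (X e) (Y e) => [[]|] [[]|].
Qed.

Lemma orthogonal_not_agree X Y h : orthogonal X Y ->
  (forall e, X e != None -> Y e != None -> X e = Y e) ->
  X h != None -> Y h = None.
Proof.
case/orP=> [dis _ Xh | /andP[_ /exists_inP[e eX /eqP XYe]] agree Xh].
  by apply/eqP; move/disjointFr: dis => /(_ h); rewrite !inE Xh => /(_ isT)/negbFE.
move: eX (agree e); rewrite inE XYe oppE.
by case: (Y e) => [[]|] //= _ /(_ isT isT); discriminate.
Qed.

Lemma orthogonal_not_disagree X Y h : orthogonal X Y ->
  (forall e, X e != None -> Y e != None -> X e = omap negb (Y e)) ->
  X h != None -> Y h = None.
Proof.
rewrite -orthogonal_oppr => oXY dis Xh; apply/eqP; rewrite -opp_eq0; apply/eqP.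
apply: orthogonal_not_agree oXY _ Xh => e Xe; rewrite opp_eq0 oppE; exact: dis.
Qed.

Lemma orthogonal_intro X Y :
  (forall h, X h != None -> Y h != None -> exists a b,
    [/\ X a != None, X a = Y a, X b != None & X b = omap negb (Y b)]) ->
  orthogonal X Y.
Proof.
move=> XY; rewrite /orthogonal.
have [//|/pred0Pn[h]] := boolP [disjoint supp X & supp Y].
rewrite /= !inE => /andP[Xh Yh].
have [a [b [Xa XYa Xb XYb]]] := XY h Xh Yh; apply/andP; split; apply/exists_inP.
  by exists a; [rewrite inE | rewrite XYa].
by exists b; [rewrite inE | rewrite oppE XYb].
Qed.

(** When only [a] and [b] can be common, one must carry the agreement and the other the
    disagreement. Signs are transferred this way between fundamental circuits and cocircuits. *)
Lemma orthogonal_pair X Y a b : orthogonal X Y ->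
  (forall h, h != a -> h != b -> X h != None -> Y h = None) ->
  X a != None -> Y a != None ->
  [/\ X b != None, Y b != None & (X a == Y a) = (X b != Y b)].
Proof.
move=> oXY XY Xa Ya.
have off h : X h != None -> Y h != None -> (h == a) || (h == b).
  move=> Xh Yh; case: (eqVneq h a) => //= ha; case: (eqVneq h b) => //= hb.
  by rewrite XY in Yh.
have [XYa|XYa] := eqVneq (X a) (Y a); last first.
  have {}XYa : X a = omap negb (Y a).
    by move: XYa Xa Ya; case: (X a) (Y a) => [[]|] [[]|].
  suff XYb : [/\ X b != None, Y b != None & X b = Y b].
    by case: XYb => -> -> ->; rewrite eqxx.
  have [/and3P[-> -> /eqP ->] //|nb] :=
    boolP [&& X b != None, Y b != None & X b == Y b].
  move: Ya; rewrite (orthogonal_not_disagree oXY _ Xa) // => h Xh Yh.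
  case/orP: (off h Xh Yh) => /eqP hE; rewrite hE // in Xh Yh *.
  by move: nb Xh Yh; case: (X b) (Y b) => [[]|] [[]|].
suff XYb : [/\ X b != None, Y b != None & X b != Y b] by case: XYb.
have [/and3P[] //|nb] := boolP [&& X b != None, Y b != None & X b != Y b].
move: Ya; rewrite (orthogonal_not_agree oXY _ Xa) // => h Xh Yh.
case/orP: (off h Xh Yh) => /eqP hE; rewrite hE // in Xh Yh *.
by move: nb; rewrite Xh Yh negbK => /eqP.
Qed.

End SignedSetLemmas.

(** * Elimination between signed circuits *)

Section Elimination.
Variables (E : finType) (M : oriented_matroid E).
Implicit Types (X Y Z W D : signed_set E) (a b e h : E).

Lemma scircuits_weak_elim X Y e : X \in scircuits M -> Y \in scircuits M ->
  X <> opp Y -> X e != None -> Y e = omap negb (X e) ->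
  exists Z, [/\ Z \in scircuits M, Z e = None &
    forall h, Z h != None -> Z h = X h \/ Z h = Y h].
Proof.
move=> XM YM XY Xe Ye.
have main X' Y' : X' \in scircuits M -> Y' \in scircuits M -> X' <> opp Y' ->
    X' e = Pos -> Y' e = Neg -> exists Z, [/\ Z \in scircuits M, Z e = None &
    forall h, Z h != None -> Z h = X' h \/ Z h = Y' h].
  move=> X'M Y'M XY' X'e Y'e.
  have [||Z [ZM /subsetP Zp /subsetP Zn]] := scircuits_elimination (e := e) X'M Y'M XY'.
  - by rewrite inE X'e.
  - by rewrite inE Y'e.
  exists Z; split=> // [|h].
    case Ze: (Z e) => [[]|] //.
      by move: (Zp e); rewrite !inE Ze eqxx => /(_ isT).
    by move: (Zn e); rewrite !inE Ze eqxx => /(_ isT).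
  case Zh: (Z h) => [[]|] // _.
    move: (Zp h); rewrite !inE Zh => /(_ isT)/andP[_ /orP[]] /eqP ->; by [left|right].
  move: (Zn h); rewrite !inE Zh => /(_ isT)/andP[_ /orP[]] /eqP ->; by [left|right].
case X_e: (X e) Xe Ye => [[]|] //= _ Ye; first exact: main.
have [|Z [ZM Ze Zh]] := main Y X YM XM _ Ye X_e.
  by move=> YX; apply: XY; rewrite YX oppK.
by exists Z; split=> // h /Zh[]; [right|left].
Qed.

Lemma scircuits_sub X Y : X \in scircuits M -> Y \in scircuits M ->
  supp X \subset supp Y -> supp X = supp Y.
Proof. by move=> XM YM /(scircuits_incomparable XM YM)[] ->; rewrite ?supp_opp. Qed.

Lemma scircuits_neq0 X : X \in scircuits M -> exists e, X e != None.
Proof.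
move=> XM; apply/existsP; apply: contraTT XM => /existsPn X0.
suff -> : X = zero_set E by exact: scircuits_nonzero.
by apply/ffunP=> e; rewrite ffunE; move: (X0 e); rewrite negbK => /eqP.
Qed.

(* A circuit [W] through [a] inside [a |: supp X] is made conformal to [X] by
   eliminating its disagreements with [X]; each result still contains [a],
   because otherwise it would lie strictly inside [X]. *)
Lemma conformal_shrink X W a : X \in scircuits M -> W \in scircuits M ->
  X a = None -> W a != None -> supp W :\ a \subset supp X ->
  exists V, [/\ V \in scircuits M, V a = W a &
    forall e, e != a -> V e != None -> V e = X e].
Proof.
move=> XM WM Xa.
have [n] := ubnP #|[set e | [&& e != a, W e != None & W e != X e]]|.
elim: n => // n IHn in W WM * => Wn Wa WX.
have [/forallP WXe|/forallPn[k]] :=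
    boolP [forall e, [&& e != a & W e != None] ==> (W e == X e)].
  exists W; split=> // e ea We; apply/eqP.
  by move: (WXe e); rewrite ea We.
rewrite negb_imply => /andP[/andP[ka Wk] WXk].
have Xk : X k != None.
  by move/subsetP: WX => /(_ k); rewrite !inE ka Wk; apply.
have WkE : W k = omap negb (X k).
  by move: Wk Xk WXk; case: (W k) (X k) => [[]|] [[]|].
have [|Z [ZM Zk Zh]] := scircuits_weak_elim XM WM _ Xk WkE.
  by move=> XW; move: Xa Wa; rewrite XW => /eqP; rewrite opp_eq0 => ->.
have Za : Z a != None.
  apply/negP=> Za; have/scircuits_sub : supp Z \subset supp X.
    apply/subsetP=> e; rewrite !inE => Ze.
    have ea : e != a by apply: contraNneq Ze => ->.
    have := Ze; case: (Zh e Ze) => -> // We.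
    by move/subsetP: WX => /(_ e); rewrite !inE ea We; apply.
  move=> /(_ ZM XM)/setP/(_ k); by rewrite !inE Zk Xk.
have ZaW : Z a = W a by have := Za; case: (Zh a Za) => // ->; rewrite Xa.
have [|||V [VM Va Vh]] := IHn Z ZM; rewrite -?ZaW //; last by exists V.
  move: Wn; rewrite ltnS; apply: leq_trans; apply: proper_card; apply/properP; split.
    apply/subsetP=> e; rewrite !inE => /and3P[-> Ze ZXe] /=.
    by move: (Ze) ZXe; case: (Zh e Ze) => -> We; rewrite ?eqxx ?We.
  by exists k; rewrite !inE ?Zk ?ka ?Wk ?WXk ?andbF.
apply/subsetP=> e; rewrite !inE => /andP[ea Ze].
have := Ze; case: (Zh e Ze) => -> // We.
by move/subsetP: WX => /(_ e); rewrite !inE ea We; apply.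
Qed.

End Elimination.

(** * Contraction of a nonloop *)

Section Contraction.
Variables (E : finType) (M : oriented_matroid E) (a : E).
Hypothesis a_nonloop : forall X, X \in scircuits M -> ~~ (supp X \subset [set a]).
Implicit Types (X Y Z W D : signed_set E) (e h : E).

(** [a] stays in the ground set with value 0, so that repeated contractions all live over the same
    [E]. *)
Definition cut X : signed_set E := [ffun e => if e == a then None else X e].

Lemma supp_cut X : supp (cut X) = supp X :\ a.
Proof. by apply/setP=> e; rewrite !inE ffunE; case: (eqVneq e a). Qed.

Lemma supp_setD1 X : X a = None -> supp X :\ a = supp X.
Proof.
by move=> Xa; apply/setP=> e; rewrite !inE; case: eqVneq => // ->; rewrite Xa.
Qed.

Lemma cut_opp X : cut (opp X) = opp (cut X).
Proof. by apply/ffunP=> e; rewrite !ffunE; case: eqP. Qed.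

Definition cut_minimal X :=
  [forall W in scircuits M, ~~ (supp W :\ a \proper supp X :\ a)].

Definition contraction_circuits : {set signed_set E} :=
  [set cut X | X in scircuits M & cut_minimal X].

Lemma contraction_circuits_at Z : Z \in contraction_circuits -> Z a = None.
Proof. by case/imsetP=> X _ ->; rewrite ffunE eqxx. Qed.

Lemma cut_minimal_mem X : X \in scircuits M -> X a != None -> cut_minimal X.
Proof.
move=> XM Xa; apply/forall_inP=> W WM; apply/negP=> /properP[/subsetP sWX [h]].
rewrite !inE => /andP[ha Xh]; rewrite ha /= => nWh.
have/(scircuits_sub WM XM)/setP/(_ h) : supp W \subset supp X.
  apply/subsetP=> e; case: (eqVneq e a) => [->|ea]; first by rewrite !inE Xa.
  by rewrite !inE => We; have := sWX e; rewrite !inE ea We; apply.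
by rewrite !inE Xh (negPf nWh).
Qed.

(** If the cut of [X] is not minimal, [X] avoids [a] and some circuit [W] through [a] stays inside
    [X] apart from [a]. Shrinking [W] and [opp W] gives [V] and [V'], conformal to [X] off [a] and
    opposite at [a]. Eliminating [a] leaves a circuit inside [X], hence with the same support, so
    [h] lies in [V] or [V']. *)
Lemma contraction_circuits_conformal X h : X \in scircuits M -> h != a ->
  X h != None -> exists Z, [/\ Z \in contraction_circuits, Z h != None &
    forall e, Z e != None -> Z e = X e].
Proof.
move=> XM ha Xh.
have cutP V : V \in scircuits M -> V h != None -> cut_minimal V ->
    (forall e, e != a -> V e != None -> V e = X e) ->
    exists Z, [/\ Z \in contraction_circuits, Z h != None &
      forall e, Z e != None -> Z e = X e].
  move=> VM Vh minV VX; exists (cut V); split.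
  - by apply: imset_f; rewrite inE VM.
  - by rewrite ffunE (negPf ha).
  - by move=> e; rewrite ffunE; case: (eqVneq e a) => // /VX.
have [minX|/forall_inPn[W WM]] := boolP (cut_minimal X); first exact: (cutP X).
rewrite negbK => WX.
have Xa : X a = None.
  apply/eqP; apply: contraLR WX => Xa.
  by move/forall_inP: (cut_minimal_mem XM Xa); apply.
rewrite (supp_setD1 Xa) in WX.
have Wa : W a != None.
  apply/negP=> /eqP Wa; move: WX; rewrite (supp_setD1 Wa) => /andP[].
  by move=> /(scircuits_sub WM XM) ->; rewrite subxx.
have sWX := proper_sub WX.
have [V [VM Va VX]] := conformal_shrink XM WM Xa Wa sWX.
have [||V' [V'M V'a V'X]] := conformal_shrink XM (scircuits_opp WM) Xa.
- by rewrite opp_eq0.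
- by rewrite supp_opp.
have Va0 : V a != None by rewrite Va.
have V'a0 : V' a != None by rewrite V'a opp_eq0.
have [||Z [ZM Za Zh]] := scircuits_weak_elim VM V'M _ Va0.
- move=> VV'; have/negP := a_nonloop VM; apply.
  apply/subsetP=> e; rewrite !inE; apply: contraNT => ea; apply/negPn/negP => Ve.
  have V'e : V' e != None by move: Ve; rewrite VV' opp_eq0.
  have := VX e ea Ve; rewrite -(V'X e ea V'e) VV' oppE.
  by case: (V' e) V'e => [[]|].
- by rewrite V'a Va oppE.
have/(scircuits_sub ZM XM)/setP/(_ h) : supp Z \subset supp X.
  apply/subsetP=> e; rewrite !inE => Ze.
  have ea : e != a by apply: contraNneq Ze => ->; rewrite Za.
  by have := Ze; case: (Zh e Ze) => -> Ve; [rewrite -(VX e ea Ve)|rewrite -(V'X e ea Ve)].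
rewrite !inE Xh => Zh0; have := Zh0; case: (Zh h Zh0) => -> Vh.
  exact: (cutP V VM Vh (cut_minimal_mem VM Va0) VX).
exact: (cutP V' V'M Vh (cut_minimal_mem V'M V'a0) V'X).
Qed.

Lemma contraction_circuits_nonzero : zero_set E \notin contraction_circuits.
Proof.
apply/imsetP=> -[X]; rewrite inE => /andP[XM _] /(congr1 (@supp E)).
rewrite supp_cut => X0; have/negP := a_nonloop XM; apply.
apply/subsetP=> e Xe; rewrite inE; apply: contraTT Xe => ea.
by move/setP/(_ e): X0; rewrite !inE ffunE ea /= => <-.
Qed.

Lemma contraction_circuits_opp X :
  X \in contraction_circuits -> opp X \in contraction_circuits.
Proof.
case/imsetP=> Y; rewrite inE => /andP[YM minY] ->; rewrite -cut_opp.
by apply: imset_f; rewrite inE scircuits_opp //= /cut_minimal supp_opp.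
Qed.

Lemma contraction_circuits_incomparable X Y :
  X \in contraction_circuits -> Y \in contraction_circuits ->
  supp X \subset supp Y -> X = Y \/ X = opp Y.
Proof.
case/imsetP=> X0; rewrite inE => /andP[X0M minX] ->{X}.
case/imsetP=> Y0; rewrite inE => /andP[Y0M minY] ->{Y}.
rewrite !supp_cut => sXY.
have eXY : supp X0 :\ a = supp Y0 :\ a.
  by apply/eqP; move/forall_inP/(_ X0 X0M): minY; rewrite properEneq sXY andbT negbK.
(* The supports now differ at most at [a], so the one without [a], if any, is contained in the
   other. *)
have sub U V : supp U :\ a = supp V :\ a -> (U a != None -> V a != None) ->
    supp U \subset supp V.
  move=> eUV UV; apply/subsetP=> e; case: (eqVneq e a) => [->|ea]; first by rewrite !inE.
  by move/setP/(_ e): eUV; rewrite !inE ea /= => ->.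
have [X0a|X0a] := eqVneq (X0 a) None.
  case: (scircuits_incomparable X0M Y0M (sub _ _ eXY _)).
  - by rewrite X0a.
  - by move->; left.
  - by move->; right; rewrite cut_opp.
case: (scircuits_incomparable Y0M X0M (sub _ _ (esym eXY) _)) => //.
- by move->; left.
- by move->; right; rewrite cut_opp oppK.
Qed.

Lemma contraction_circuits_elimination X Y e :
  X \in contraction_circuits -> Y \in contraction_circuits -> X <> opp Y ->
  e \in pos_part X -> e \in neg_part Y ->
  exists Z, [/\ Z \in contraction_circuits,
    pos_part Z \subset (pos_part X :|: pos_part Y) :\ e &
    neg_part Z \subset (neg_part X :|: neg_part Y) :\ e].
Proof.
case/imsetP=> X0; rewrite inE => /andP[X0M _] ->{X}.
case/imsetP=> Y0; rewrite inE => /andP[Y0M _] ->{Y}.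
move=> XY; rewrite !inE !ffunE; case: (eqVneq e a) => // ea /eqP X0e /eqP Y0e.
have [|||Z0 [Z0M Z0e Z0h]] := scircuits_weak_elim X0M Y0M (e := e).
- by move=> XY0; apply: XY; rewrite XY0 cut_opp.
- by rewrite X0e.
- by rewrite Y0e X0e.
(* As [a] is not a loop, [Z0] has an element [h] off [a]; any contraction circuit through [h]
   conformal to [Z0] will do. *)
have/subsetPn[h] := a_nonloop Z0M; rewrite !inE => Z0h0 ha.
have [Z [ZC _ ZZ0]] := contraction_circuits_conformal Z0M ha Z0h0.
have Za := contraction_circuits_at ZC.
have Zk k s : Z k = Some s -> k != e /\ (cut X0 k = Some s \/ cut Y0 k = Some s).
  move=> Zk; have := ZZ0 k; rewrite Zk => /(_ isT) Z0k.
  have ka : k != a by apply: contra_eqN Zk => /eqP ->; rewrite Za.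
  split; first by apply: contra_eqN (esym Z0k) => /eqP ->; rewrite Z0e.
  rewrite !ffunE (negPf ka).
  by have := Z0h k; rewrite -Z0k => /(_ isT)[] <-; [left|right].
exists Z; split=> //; apply/subsetP=> k; rewrite !(in_setD1, in_setU) !inE.
  by move/eqP/Zk=> [-> [->|->]]; rewrite eqxx ?orbT.
by move/eqP/Zk=> [-> [->|->]]; rewrite eqxx ?orbT.
Qed.

(* The contraction of [a], with [a] put back as a coloop. *)
Definition contraction : oriented_matroid E :=
  OrientedMatroid contraction_circuits_nonzero contraction_circuits_opp
    contraction_circuits_incomparable contraction_circuits_elimination.

Lemma contractionP Z : Z \in scircuits contraction ->
  exists2 X, X \in scircuits M & Z = cut X.
Proof. by case/imsetP=> X; rewrite inE => /andP[XM _] ->; exists X. Qed.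

End Contraction.

(** * Signing the cocircuits *)

Section Signing.
Variable E : finType.
Implicit Types (M : oriented_matroid E) (X Y Z D F : signed_set E).
Implicit Types (A : {set E}) (a e h u v : E).

(** Each element other than [e0] is a loop, parallel to [e0], or in no circuit. The circuit [F e] on
    [e] and [e0] dictates the sign [D e]. A circuit with two elements [u] and [v] off [e0] is, up to
    sign, obtained by eliminating [e0] between [F u] and plus or minus [F v]. *)
Lemma signing_rank1 M e0 :
  (forall X, X \in scircuits M -> ~~ (supp X \subset [set e0])) ->
  (forall e, e != e0 -> (exists X, [/\ X \in scircuits M, X e != None &
     supp X \subset [set e; e0]]) \/
     forall X, X \in scircuits M -> X e = None) ->
  exists2 D : signed_set E, D e0 = Pos &
    forall X, X \in scircuits M -> orthogonal X D.
Proof.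
move=> e0_nonloop spans.
(* The default [zero_set E] makes [D] vanish on elements in no circuit. *)
pose F e := odflt (zero_set E)
  [pick X in scircuits M | (X e == Pos) && (supp X \subset [set e; e0])].
have FP e : e != e0 -> (exists2 X, X \in scircuits M & X e != None) ->
    [/\ F e \in scircuits M, F e e = Pos &
      forall h, h != e -> h != e0 -> F e h = None].
  move=> ee0 [X XM Xe]; rewrite /F.
  case: pickP => [Y /and3P[YM /eqP Ye /subsetP sY]|noY] /=.
    split=> // h he he0; apply/eqP; apply/negPn/negP => Yh.
    by have := sY h; rewrite !inE Yh (negPf he) (negPf he0) => /(_ isT).
  have [[Y [YM Ye sY]]|Xe0] := spans e ee0; last by rewrite Xe0 in Xe.
  case Y_e: (Y e) Ye => [[]|] // _; first by have := noY Y; rewrite YM Y_e sY.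
  by have := noY (opp Y); rewrite scircuits_opp // oppE Y_e supp_opp sY.
pose D : signed_set E := [ffun e => if e == e0 then Pos else opp (F e) e0].
have De e : e != e0 -> D e = omap negb (F e e0).
  by move=> ee0; rewrite ffunE (negPf ee0) oppE.
have D0 : D e0 = Pos by rewrite ffunE eqxx.
exists D => // X XM; apply: orthogonal_intro => h Xh Dh.
have/subsetPn[u] := e0_nonloop X XM; rewrite !inE => Xu ue0.
have [FuM Fuu Fuh] := FP u ue0 (ex_intro2 _ _ X XM Xu).
have [sX|] := boolP (supp X \subset [set u; e0]).
  have {sX}Xoff e : e != u -> e != e0 -> X e = None.
    move=> eu ee0; apply/eqP; apply/negPn/negP => Xe.
    by move/subsetP/(_ e): sX; rewrite !inE Xe (negPf eu) (negPf ee0) => /(_ isT).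
  have XF : X = F u \/ X = opp (F u).
    have [Fu0|Fu0] := eqVneq (F u e0) None.
      case: (scircuits_incomparable FuM XM) => [|->|->]; rewrite ?oppK; auto.
      apply/subsetP=> e; rewrite !inE => Fe; have [->//|eu] := eqVneq e u.
      have [ee0|ee0] := eqVneq e e0; first by rewrite ee0 Fu0 in Fe.
      by rewrite Fuh in Fe.
    apply: (scircuits_incomparable XM FuM).
    apply/subsetP=> e; rewrite !inE => Xe; have [->|eu] := eqVneq e u.
      by rewrite Fuu.
    by have [->//|ee0] := eqVneq e e0; rewrite Xoff in Xe.
  have Fu0 : F u e0 != None.
    have [hu|hu] := eqVneq h u; first by move: Dh; rewrite hu De //; case: (F u e0).
    have [he0|he0] := eqVneq h e0; last by rewrite Xoff in Xh.
    by rewrite he0 in Xh; case: XF Xh => ->; rewrite ?opp_eq0.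
  have Du := De u ue0.
  case Fe0: (F u e0) Fu0 Du => [[]|] // _ /= Du; case: XF => XE.
  - by exists e0, u; rewrite XE Fe0 Fuu Du D0.
  - by exists u, e0; rewrite XE !oppE Fe0 Fuu Du D0.
  - by exists u, e0; rewrite XE Fe0 Fuu Du D0.
  - by exists e0, u; rewrite XE !oppE Fe0 Fuu Du D0.
case/subsetPn=> v; rewrite !inE negb_or => Xv /andP[vu ve0].
have [FvM Fvv Fvh] := FP v ve0 (ex_intro2 _ _ X XM Xv).
have Fe0 w w' : X w != None -> X w' != None -> w' != w -> w != e0 -> w' != e0 ->
    F w \in scircuits M -> F w w = Pos ->
    (forall h, h != w -> h != e0 -> F w h = None) -> F w e0 != None.
  move=> Xw Xw' w'w we0 w'e0 FM Fw Foff; apply/negP=> /eqP F0.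
  have/(scircuits_sub FM XM)/setP/(_ w') : supp (F w) \subset supp X.
    apply/subsetP=> e; rewrite !inE => Fe; have [->//|ew] := eqVneq e w.
    have [ee0|ee0] := eqVneq e e0; first by rewrite ee0 F0 in Fe.
    by rewrite Foff in Fe.
  by rewrite !inE Xw' Foff.
have uv : u != v by rewrite eq_sym.
have Fu0 := Fe0 u v Xu Xv vu ue0 ve0 FuM Fuu Fuh.
have Fv0 : F v e0 != None by exact: (Fe0 v u).
(* [G] is whichever of [F v] and [opp (F v)] is opposite to [F u] at [e0]. *)
have [G [GM Gv Gh GE]] : exists G, [/\ G \in scircuits M, G e0 = omap negb (F u e0),
    forall h, h != v -> h != e0 -> G h = None &
    G v = Some (F v e0 != F u e0)].
  have [FE|FE] := eqVneq (F v e0) (F u e0); last first.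
    exists (F v); split=> //; move: FE Fu0 Fv0.
    by case: (F u e0) (F v e0) => [[]|] [[]|].
  exists (opp (F v)); rewrite !oppE FE Fvv; split=> // [|k kv ke0].
    exact: scircuits_opp.
  by rewrite oppE Fvh.
have [|Z [ZM Z0 Zh]] := scircuits_weak_elim FuM GM _ Fu0 Gv.
  by move/ffunP/(_ u); rewrite oppE Fuu Gh.
have Zoff e : e != u -> e != v -> Z e = None.
  move=> eu ev; have [->//|ee0] := eqVneq e e0; apply/eqP/negPn/negP=> Ze.
  by have := Ze; case: (Zh e Ze) => ->; rewrite ?Fuh ?Gh.
have XZ : Z = X \/ Z = opp X.
  apply: (scircuits_incomparable ZM XM); apply/subsetP=> e; rewrite !inE => Ze.
  have [->//|eu] := eqVneq e u; have [->//|ev] := eqVneq e v.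
  by rewrite Zoff in Ze.
have Zu : Z u = Pos.
  have Zu0 : Z u != None by case: XZ => ->; rewrite ?opp_eq0.
  by have := Zu0; case: (Zh u Zu0) => ->; rewrite ?Gh.
have Zv : Z v = Some (F v e0 != F u e0).
  have Zv0 : Z v != None by case: XZ => ->; rewrite ?opp_eq0.
  by have := Zv0; case: (Zh v Zv0) => ->; rewrite ?(Fuh v) ?GE.
have [Du Dv] := (De u ue0, De v ve0).
have [[XuE XvE]|[XuE XvE]] : X u = Z u /\ X v = Z v \/
    X u = omap negb (Z u) /\ X v = omap negb (Z v).
- by case: XZ => ->; rewrite ?oppE; [left | right; case: (X u) (X v) => [[]|] [[]|]].
- case Fe0u: (F u e0) (F v e0) Fu0 Fv0 Du Dv Zv => [[]|] // [[]|] // _ _ /= Du Dv Zv;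
  by [exists u, v; rewrite XuE XvE Zu Zv Du Dv | exists v, u; rewrite XuE XvE Zu Zv Du Dv].
case Fe0u: (F u e0) (F v e0) Fu0 Fv0 Du Dv Zv => [[]|] // [[]|] // _ _ /= Du Dv Zv;
  by [exists u, v; rewrite XuE XvE Zu Zv Du Dv | exists v, u; rewrite XuE XvE Zu Zv Du Dv].
Qed.

(** Induction on the size of [A], contracting one of its elements. The second alternative for [e]
    accommodates contracted elements, which stay in the ground set but lie in no circuit. *)
Lemma signing_exists M A e0 : e0 \notin A ->
  (forall X, X \in scircuits M -> ~~ (supp X \subset e0 |: A)) ->
  (forall e, e \notin e0 |: A ->
    (exists X, [/\ X \in scircuits M, X e != None & supp X \subset e |: (e0 |: A)]) \/
    forall X, X \in scircuits M -> X e = None) ->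
  exists D : signed_set E, [/\ D e0 = Pos, forall a, a \in A -> D a = None &
    forall X, X \in scircuits M -> orthogonal X D].
Proof.
have [n] := ubnP #|A|; elim: n => // n IHn in M A * => An e0A indA spanA.
have [A0|[a aA]] := set_0Vmem A.
  rewrite A0 setU0 in indA spanA.
  have [|D D0 Dorth] := @signing_rank1 M e0 indA.
    by move=> e ee0; apply: spanA; rewrite inE.
  by exists D; split=> // a; rewrite A0 inE.
have ae0 : a != e0 by apply: contraNneq e0A => <-.
have nonloop X : X \in scircuits M -> ~~ (supp X \subset [set a]).
  move=> /indA; apply: contra => /subset_trans; apply.
  by rewrite sub1set !inE aA orbT.
pose M1 := contraction nonloop.
have [||||D [D0 DA Dorth]] := IHn M1 (A :\ a).
- by rewrite (cardsD1 a) aA in An.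
- by rewrite !inE negb_and e0A orbT.
- move=> _ /contractionP[X XM ->]; apply: contra (indA X XM).
  rewrite supp_cut => /subsetP sX; apply/subsetP=> e Xe.
  case: (eqVneq e a) => [->|ea]; first by rewrite !inE aA orbT.
  by have := sX e; rewrite in_setD1 ea Xe !inE ea; apply.
- move=> e; rewrite !inE => eA.
  have [->|ea] := eqVneq e a.
    by right=> _ /contractionP[X XM ->]; rewrite ffunE eqxx.
  rewrite ea /= in eA.
  have [|[X [XM Xe sX]]|eM] := spanA e; first by rewrite !inE.
    left; have [Z [ZM Ze ZX]] := contraction_circuits_conformal nonloop XM ea Xe.
    exists Z; split=> //; apply/subsetP=> h; rewrite !inE => Zh.
    have ha : h != a.
      by apply: contraNneq Zh => ->; rewrite (contraction_circuits_at ZM).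
    by move/subsetP/(_ h): sX; rewrite !inE -(ZX h Zh) Zh ha; apply.
  by right=> _ /contractionP[X XM ->]; rewrite ffunE eM // if_same.
(* The inductive [D] is unconstrained at [a], so it is set to 0 there. *)
exists (cut a D); split.
- by rewrite ffunE eq_sym (negPf ae0).
- by move=> b bA; rewrite ffunE; case: eqVneq => // ba; rewrite DA // !inE ba.
move=> X XM; apply: orthogonal_intro => h Xh; rewrite ffunE.
have [//|ha Dh] := eqVneq h a.
(* A contraction circuit through [h] conformal to [X] passes its agreement and disagreement with [D]
   on to [X]. *)
have [Z [ZM Zh ZX]] := contraction_circuits_conformal nonloop XM ha Xh.
have Za e : Z e != None -> e != a.
  by apply: contraNneq => ->; rewrite (contraction_circuits_at ZM).
case/orP: (Dorth Z ZM) => [|/andP[/exists_inP[b bZ /eqP Zb] /exists_inP[c cZ /eqP Zc]]].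
  by move/disjointFr=> /(_ h); rewrite !inE Zh Dh => /(_ isT).
rewrite !inE in bZ cZ.
exists b, c; rewrite -(ZX b bZ) -(ZX c cZ) !ffunE (negPf (Za b bZ)).
by rewrite (negPf (Za c cZ)) -oppE -Zc.
Qed.

End Signing.

(** * Bases, exchange and signed cocircuits *)

Section MatroidLemmas.
Variables (E : finType) (M : oriented_matroid E).
Implicit Types (X Y Z D : signed_set E) (A B I : {set E}) (a e h x y : E).

Lemma indepP A :
  reflect (forall X, X \in scircuits M -> ~~ (supp X \subset A)) (indep M A).
Proof.
apply: (iffP forall_inP) => [indA X XM|indA _ /imsetP[X XM ->]]; last exact: indA.
by apply: indA; apply: imset_f.
Qed.

Lemma indepPn A :
  reflect (exists2 X, X \in scircuits M & supp X \subset A) (~~ indep M A).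
Proof.
apply: (iffP idP) => [/forall_inPn[_ /imsetP[X XM ->]]|[X XM XA]].
  by rewrite negbK; exists X.
by apply/negP=> /indepP/(_ X XM); rewrite XA.
Qed.

Lemma indep_sub A B : A \subset B -> indep M B -> indep M A.
Proof.
move=> AB /indepP indB; apply/indepP=> X /indB; apply: contra => XA.
exact: subset_trans XA AB.
Qed.

Lemma basis_indep B : B \in bases M -> indep M B.
Proof. by rewrite inE => /maxsetp. Qed.

Lemma basis_circuit B e : B \in bases M -> e \notin B ->
  exists X, [/\ X \in scircuits M, X e != None & supp X \subset e |: B].
Proof.
rewrite inE => /maxsetP[indB maxB] eB.
have/indepPn[X XM XeB] : ~~ indep M (e |: B).
  apply: contra eB => /maxB <-; first exact: setU11.
  exact: subsetUr.
exists X; split=> //; move/indepP/(_ X XM): indB; apply: contraNneq => Xe.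
apply/subsetP=> h Xh; move/subsetP/(_ h Xh): XeB; rewrite !inE.
by case: eqVneq => // he; rewrite inE he Xe in Xh.
Qed.

Lemma basis_intro B : indep M B ->
  (forall e, e \notin B -> exists2 X, X \in scircuits M & supp X \subset e |: B) ->
  B \in bases M.
Proof.
move=> indB maxB; rewrite inE; apply/maxsetP; split=> // A indA BA.
apply/eqP; rewrite eqEsubset BA andbT; apply/subsetP=> e eA.
apply/negPn/negP=> /maxB[X XM XeB]; move/indepP/(_ X XM)/negP: indA; apply.
by apply: subset_trans XeB _; rewrite subUset sub1set eA.
Qed.

Lemma indep_basis I : indep M I -> exists2 B, B \in bases M & I \subset B.
Proof. by case/maxset_exists=> B maxB IB; exists B => //; rewrite inE. Qed.

Lemma elim_common X Y e y : X \in scircuits M -> Y \in scircuits M ->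
  X e != None -> Y e != None -> X y = None -> Y y != None ->
  exists2 Z, Z \in scircuits M & supp Z \subset (supp X :|: supp Y) :\ e.
Proof.
move=> XM YM Xe Ye Xy Yy.
have [Y' [Y'M Y'e sY' Y'y]] : exists Y', [/\ Y' \in scircuits M,
    Y' e = omap negb (X e), supp Y' = supp Y & Y' y != None].
  have [XY|XY] := eqVneq (X e) (Y e).
    exists (opp Y); rewrite oppE XY supp_opp opp_eq0; split=> //.
    exact: scircuits_opp.
  exists Y; split=> //; move: Xe Ye XY.
  by case: (X e) (Y e) => [[]|] [[]|].
have [|Z [ZM Ze Zh]] := scircuits_weak_elim XM Y'M _ Xe Y'e.
  by move=> XY'; move: Y'y; rewrite -opp_eq0 -XY' Xy.
exists Z => //; apply/subsetP=> h; rewrite -sY' !inE => Zh0.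
rewrite (contraNneq _ Zh0) => [|->]; last by rewrite Ze.
by have := Zh0; case: (Zh h Zh0) => -> ->; rewrite ?orbT.
Qed.

(** Eliminating [x] against [X] turns a circuit inside the new set into one inside [B]. For
    maximality, a fundamental circuit over [B] that uses [y] is rid of it by elimination against
    [X]. *)
Lemma basis_exchange B X x y : B \in bases M -> X \in scircuits M ->
  x \notin B -> supp X \subset x |: B -> y \in B -> X y != None ->
  x |: B :\ y \in bases M.
Proof.
move=> Bb XM xB XxB yB Xy.
have indB := basis_indep Bb.
have yx : y != x by apply: contraNneq xB => <-.
have not_in_B Z : Z \in scircuits M -> supp Z \subset B -> False.
  by move=> ZM ZB; move/indepP/(_ Z ZM): indB; rewrite ZB.
have Xx : X x != None.
  apply/negP=> Xx; apply: (not_in_B X XM); apply/subsetP=> e Xe.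
  move/subsetP/(_ e Xe): XxB; rewrite !inE.
  by case: eqVneq => // ex; rewrite inE ex Xx in Xe.
apply: basis_intro => [|e].
  apply/indepP=> Z ZM; apply/negP=> ZB.
  have Zy : Z y = None.
    apply/eqP/negPn/negP=> Zy; move/subsetP/(_ y): ZB.
    by rewrite !inE Zy eqxx (negPf yx) => /(_ isT).
  have Zx : Z x != None.
    apply/negP=> Zx; apply: (not_in_B Z ZM); apply/subsetP=> e Ze.
    move/subsetP/(_ e Ze): ZB; rewrite !inE.
    by case: (eqVneq e x) => [ex|_ /andP[]//]; rewrite inE ex Zx in Ze.
  have [W WM sW] := elim_common ZM XM Zx Xx Zy Xy.
  apply: (not_in_B W WM); apply: subset_trans sW _.
  apply/subsetP=> e; rewrite in_setD1 => /andP[ex]; rewrite in_setU => /orP[Ze|Xe].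
    by move/subsetP/(_ e Ze): ZB; rewrite !inE (negPf ex) => /andP[].
  by move/subsetP/(_ e Xe): XxB; rewrite !inE (negPf ex).
have [->|ey] := eqVneq e y.
  exists X => //; apply: subset_trans XxB _; apply/subsetP=> h; rewrite !inE.
  by case: eqVneq => //= _; case: eqVneq.
rewrite !inE ey /= negb_or => /andP[ex eB].
have [C [CM Ce sC]] := basis_circuit Bb eB.
have CE h : C h != None -> h != y -> h \in e |: (x |: B :\ y).
  move=> Ch hy; move/subsetP/(_ h): sC; rewrite !inE Ch hy => /(_ isT).
  by case/orP=> ->; rewrite ?orbT.
have [Cy|Cy] := eqVneq (C y) None.
  exists C => //; apply/subsetP=> h; rewrite inE => Ch; apply: CE => //.
  by apply: contraNneq Ch => ->; rewrite Cy.
have Xe : X e = None.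
  apply/eqP/negPn/negP=> Xe; move/subsetP/(_ e): XxB.
  by rewrite !inE Xe (negPf ex) (negPf eB) => /(_ isT).
have [Z ZM sZ] := elim_common XM CM Xy Cy Xe Ce.
exists Z => //; apply: subset_trans sZ _; apply/subsetP=> h.
rewrite in_setD1 => /andP[hy]; rewrite in_setU => /orP[Xh|]; last first.
  by rewrite inE => Ch; apply: CE.
by move/subsetP/(_ h Xh): XxB; rewrite !inE hy => /orP[] ->; rewrite ?orbT.
Qed.

(** An element of [I] outside [B] is exchanged for an element of its fundamental circuit outside
    [I]: [B] keeps its size and [I :\: B] shrinks. *)
Lemma indep_card I B : indep M I -> B \in bases M -> #|I| <= #|B|.
Proof.
move=> indI; have [n] := ubnP #|I :\: B|; elim: n => // n IHn in B * => In Bb.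
have [/subset_leq_card//|/subsetPn[x xI xB]] := boolP (I \subset B).
have [X [XM Xx sX]] := basis_circuit Bb xB.
have/subsetPn[y Xy yI] : ~~ (supp X \subset I) by move/indepP: indI; apply.
have yB : y \in B.
  move/subsetP/(_ y Xy): sX; rewrite !inE.
  by case: eqVneq => // yx; rewrite yx xI in yI.
rewrite inE in Xy.
have B'b := basis_exchange Bb XM xB sX yB Xy.
have <- : #|x |: B :\ y| = #|B|.
  rewrite cardsU1 (cardsD1 y B) yB !inE (negPf xB) andbF.
  by [].
apply: IHn B'b; rewrite ltnS in In; apply: leq_trans In.
apply: proper_card; apply/properP; split; last first.
  by exists x; rewrite !inE ?xI ?xB ?eqxx.
apply/subsetP=> h; rewrite !inE negb_or negb_and negbK => /andP[/andP[_ /orP[/eqP ->|->//]]].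
by rewrite (negPf yI).
Qed.

Lemma indep_rank I : indep M I -> #|I| <= rank M [set: E].
Proof. by move=> indI; apply: leq_bigmax_cond; rewrite subsetT. Qed.

Lemma basis_rank B : B \in bases M -> rank M [set: E] = #|B|.
Proof.
move=> Bb; apply/eqP; rewrite eqn_leq indep_rank ?basis_indep // andbT.
by apply/bigmax_leqP=> I /andP[_ indI]; apply: indep_card.
Qed.

Lemma indep_card_basis I : indep M I -> rank M [set: E] <= #|I| -> I \in bases M.
Proof.
move=> indI rI; have [B Bb IB] := indep_basis indI.
suff /eqP-> : I == B by [].
by rewrite eqEcard IB -(basis_rank Bb).
Qed.

Lemma rank_witness A : exists I, [/\ I \subset A, indep M I & #|I| = rank M A].
Proof.
have ind0 : (set0 \subset A) && indep M set0.
  rewrite sub0set; apply/indepP=> X XM; rewrite subset0; apply/negP=> /eqP X0.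
  have [e] := scircuits_neq0 XM; have := in_set0 e.
  by rewrite -X0 inE => ->.
rewrite /rank (bigmax_eq_arg set0 ind0).
by case: arg_maxnP => // I /andP[IA indI] _; exists I.
Qed.

(** The fundamental circuit of [x] meets [D] at [x] and otherwise at most at [e], so orthogonality
    forces it through [e]. *)
Lemma orthogonal_exchange B e D x : B \in bases M -> e \in B ->
  (forall a, a \in B -> a != e -> D a = None) ->
  (forall X, X \in scircuits M -> orthogonal X D) ->
  x \notin B -> D x != None -> x |: B :\ e \in bases M.
Proof.
move=> Bb eB DB Dorth xB Dx; have [X [XM Xx sX]] := basis_circuit Bb xB.
apply: (basis_exchange Bb XM xB sX eB).
case: (orthogonal_pair (b := e) (Dorth X XM) _ Xx Dx) => // k kx ke Xk.
by move/subsetP/(_ k): sX; rewrite !inE Xk (negPf kx) => /(_ isT) kB; apply: DB.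
Qed.

(* A signing is only required to have the right intersection with one basis:
   orthogonality forces the support to be a cocircuit. *)
Lemma orthogonal_cocircuit B e D : B \in bases M -> e \in B ->
  D e != None -> (forall a, a \in B -> a != e -> D a = None) ->
  (forall X, X \in scircuits M -> orthogonal X D) -> D \in scocircuits M.
Proof.
move=> Bb eB De DB Dorth; rewrite inE; apply/andP; split; last exact/forall_inP.
rewrite inE; apply/minsetP; split=> [|A].
  apply/negP=> /exists_inP[B' B'b DB'].
  have eB' : e \notin B' by move/subsetP/(_ e): DB'; rewrite !inE => ->.
  have [X [XM Xe sX]] := basis_circuit B'b eB'.
  case: (orthogonal_pair (b := e) (Dorth X XM) _ Xe De) => [h he _ Xh|_ _].
    move/subsetP/(_ h): sX; rewrite !inE Xh (negPf he) => /(_ isT) /= hB'.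
    apply/eqP/negPn/negP=> Dh; move/subsetP/(_ h): DB'.
    by rewrite !inE Dh hB' => /(_ isT).
  by case: eqVneq.
move=> meetA AD; apply/eqP; rewrite eqEsubset AD; apply/subsetP=> x Dx.
apply/negPn/negP=> xA; move/exists_inPn: meetA => meetA.
have AB a : a \in A -> a \in B -> a = e.
  move=> aA aB; apply/eqP; apply: contraT => ae.
  by move/subsetP/(_ a aA): AD; rewrite inE DB.
have/subsetPn[e' e'A] := meetA B Bb; rewrite inE negbK => e'B.
have eA : e \in A by rewrite -(AB e' e'A e'B).
have xe : x != e by apply: contraNneq xA => ->.
rewrite inE in Dx.
have xB : x \notin B by apply: contraNN Dx => xB; rewrite DB.
(* [A] meets [B] only at [e] and misses [x], so it misses the exchanged basis. *)
have/negP := meetA _ (orthogonal_exchange Bb eB DB Dorth xB Dx); apply.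
apply/subsetP=> a aA; rewrite !inE negb_or negb_and negbK.
rewrite (contraNneq _ xA) => [|<- //]; rewrite orbC -implybE.
by apply/implyP=> aB; rewrite (AB a aA aB).
Qed.

Lemma scocircuit_exists B e : B \in bases M -> e \in B ->
  exists D, [/\ D \in scocircuits M, D e = Pos &
    forall a, a \in B -> a != e -> D a = None].
Proof.
move=> Bb eB; have BE : e |: B :\ e = B by rewrite setD1K.
have [|||D [De DB Dorth]] := @signing_exists E M (B :\ e) e; rewrite ?BE.
- by rewrite !inE eqxx.
- by move/basis_indep/indepP: Bb.
- by move=> x /(basis_circuit Bb) ?; left.
have {}DB a : a \in B -> a != e -> D a = None by move=> aB ae; apply: DB; rewrite !inE ae.
exists D; split=> //; apply: orthogonal_cocircuit Bb eB _ DB Dorth.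
by rewrite De.
Qed.

Lemma scocircuit_orthogonal D X :
  D \in scocircuits M -> X \in scircuits M -> orthogonal X D.
Proof. by rewrite inE => /andP[_ /forall_inP]; apply. Qed.

Lemma scocircuits_opp D : D \in scocircuits M -> opp D \in scocircuits M.
Proof.
rewrite !inE supp_opp => /andP[-> /forall_inP Dorth]; apply/forall_inP=> X XM.
by rewrite orthogonal_oppr Dorth.
Qed.

(** The fundamental circuit of [x] over [B] meets [D1] and [D2] at most at [e] and [x], so the sign
    at [e] dictates the one at [x]. *)
Lemma orthogonal_unique B e D1 D2 : B \in bases M -> e \in B ->
  (forall X, X \in scircuits M -> orthogonal X D1) ->
  (forall X, X \in scircuits M -> orthogonal X D2) ->
  (forall a, a \in B -> a != e -> D1 a = None) ->
  (forall a, a \in B -> a != e -> D2 a = None) ->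
  D1 e = D2 e -> D1 e != None -> D1 = D2.
Proof.
move=> Bb eB o1 o2 D1B D2B D12 D1e; apply/ffunP=> x.
have [xB|xB] := boolP (x \in B).
  by have [->//|xe] := eqVneq x e; rewrite D1B ?D2B.
have D2e : D2 e != None by rewrite -D12.
have [X [XM Xx sX]] := basis_circuit Bb xB.
have XB h D : (forall a, a \in B -> a != e -> D a = None) ->
    h != e -> h != x -> X h != None -> D h = None.
  move=> DB he hx Xh; apply: DB => //.
  by move/subsetP/(_ h): sX; rewrite !inE Xh (negPf hx); apply.
have [Xe|Xe] := eqVneq (X e) None.
  have D0 D : (forall X, X \in scircuits M -> orthogonal X D) ->
      (forall a, a \in B -> a != e -> D a = None) -> D x = None.
    move=> oD DB; apply/eqP/negPn/negP=> Dx.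
    case: (orthogonal_pair (b := e) (oD X XM) _ Xx Dx) => [h hx he Xh|].
      exact: XB.
    by rewrite Xe.
  by rewrite !D0.
have [_ D1x e1] := orthogonal_pair (o1 X XM) (fun h he hx => XB h D1 D1B he hx) Xe D1e.
have [_ D2x e2] := orthogonal_pair (o2 X XM) (fun h he hx => XB h D2 D2B he hx) Xe D2e.
move: e1 D1x D2x Xx; rewrite D12 e2.
by case: (D1 x) (D2 x) (X x) => [[]|] [[]|] // [[]|].
Qed.

(** By minimality [A :\ e] misses some basis; that basis meets [A], hence exactly at [e]. *)
Lemma cocircuit_basis A : A \in cocircuits M ->
  exists B e, [/\ B \in bases M, e \in B, e \in A & forall a, a \in B -> a != e -> a \notin A].
Proof.
rewrite inE => /minsetP[meetA minA].
have [e eA] : exists e, e \in A.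
  apply/set0Pn; apply: contra meetA => /eqP ->; apply/exists_inP.
  have [|B Bb _] := @indep_basis set0; last by exists B; rewrite ?sub0set.
  by have [I [_ indI _]] := rank_witness set0; apply: indep_sub indI; rewrite sub0set.
have/existsP[B /andP[Bb AB]] : [exists B in bases M, A :\ e \subset ~: B].
  apply: contraT => meetAe; have/setP/(_ e) := minA _ meetAe (subD1set A e).
  by rewrite eA !inE eqxx.
have notA a : a \in B -> a != e -> a \notin A.
  move=> aB ae; apply: contraTN aB => aA.
  by move/subsetP/(_ a): AB; rewrite !inE ae aA; apply.
exists B, e; split=> //; apply: contraNT meetA => eB; apply/exists_inP.
exists B => //; apply/subsetP=> a aA; rewrite inE; apply: contraL aA => aB.
by apply: notA => //; apply: contraNneq eB => <-.
Qed.

Lemma scocircuit_basis D : D \in scocircuits M ->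
  exists B e, [/\ B \in bases M, e \in B, D e != None &
    forall a, a \in B -> a != e -> D a = None].
Proof.
rewrite inE => /andP[/cocircuit_basis[B [e [Bb eB De DB]]] _].
rewrite inE in De; exists B, e; split=> // a aB ae.
by have := DB a aB ae; rewrite inE negbK => /eqP.
Qed.

(** The signed cocircuit built from [B] and [e] lies inside [A]: an element of it outside [A] could
    be exchanged for [e], giving a basis that misses [A]. Minimality of [A] then gives equality. *)
Lemma cocircuit_signed A : A \in cocircuits M ->
  exists2 D, D \in scocircuits M & supp D = A.
Proof.
move=> Ac; have [B [e [Bb eB eA AB]]] := cocircuit_basis Ac.
have [D [DM De DB]] := scocircuit_exists Bb eB; exists D => //.
move: Ac; rewrite inE => /minsetP[meetA minA]; apply: minA; last first.
  apply/subsetP=> x Dx; apply: contraNT meetA => xA; apply/exists_inP.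
  rewrite inE in Dx.
  have xe : x != e by apply: contraNneq xA => ->.
  have xB : x \notin B by apply: contraNN Dx => xB; rewrite DB.
  exists (x |: B :\ e).
    by apply: orthogonal_exchange DB _ xB Dx => // X; apply: scocircuit_orthogonal.
  apply/subsetP=> a aA; rewrite !inE negb_or negb_and negbK.
  rewrite (contraNneq _ xA) => [|<- //] /=; have [//|ae] := eqVneq a e.
  by apply: contraL aA => aB; apply: AB.
by move: DM; rewrite inE => /andP[]; rewrite inE => /minsetp.
Qed.

End MatroidLemmas.

(** * Generic extensions and liftings *)

Section Extension.
Variables (E : finType) (M : oriented_matroid E) (N : oriented_matroid (option E)).
Hypothesis extN : generic_extension M N.
Implicit Types (B : {set E}) (e : E).

Lemma ext_scircuit X : X \in scircuits M ->
  exists X', [/\ X' \in scircuits N, X' None = None & restr X' = X].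
Proof.
case: extN => [[_ ->] _] /imsetP[X']; rewrite inE => /andP[X'N /eqP X'0] ->.
by exists X'.
Qed.

Lemma ext_restr X' : X' \in scircuits N -> X' None = None -> restr X' \in scircuits M.
Proof.
case: extN => [[_ ->] _] X'N X'0; apply/imsetP; exists X' => //.
by rewrite inE X'N X'0.
Qed.

Lemma ext_basis B : B \in bases M -> Some @: B \in bases N.
Proof.
move=> Bb; apply: indep_card_basis; last first.
  case: extN => [[-> _] _]; rewrite (basis_rank Bb) card_imset //.
  exact: Some_inj.
apply/indepP=> X' X'N; apply/negP=> /subsetP sX'.
have X'0 : X' None = None.
  apply/eqP/negPn/negP=> X'0; have := sX' None; rewrite inE X'0 => /(_ isT).
  by case/imsetP.
move/basis_indep/indepP/(_ _ (ext_restr X'N X'0))/negP: Bb; apply.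
apply/subsetP=> e; rewrite inE ffunE => X'e.
have := sX' (Some e); rewrite inE X'e => /(_ isT)/imsetP[e' e'B [->]] //.
Qed.

(** By genericity the fundamental circuit of [None] is spanning, so it properly contains an
    independent set of size [#|B|] and must be all of [B] plus [None]. *)
Lemma ext_circuit B : B \in bases M -> exists C,
  [/\ C \in scircuits N, C None = Neg & forall e, (C (Some e) != None) = (e \in B)].
Proof.
move=> Bb; have Nb := ext_basis Bb.
have [|C [CN C0 sC]] := basis_circuit (e := None) Nb; first by apply/imsetP => -[].
have [I [IC indI cardI]] := rank_witness N (supp C).
have eC : supp C = None |: Some @: B.
  apply/eqP; rewrite eqEcard sC cardsU1.
  have -> : None \notin Some @: B by apply/imsetP => -[].
  rewrite -(basis_rank Nb) add1n; case: extN => _ /(_ (supp C)).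
  rewrite /spanning -cardI inE C0 imset_f // => /(_ isT isT)/eqP <-.
  apply: proper_card; rewrite properEneq IC andbT.
  apply/eqP=> IE; move/indepP/(_ C CN): indI; by rewrite IE subxx.
have Ce e : (C (Some e) != None) = (e \in B).
  move/setP/(_ (Some e)): eC; rewrite !inE => ->.
  by rewrite mem_imset //; exact: Some_inj.
case C0E: (C None) C0 => [[]|] // _; last by exists C.
exists (opp C); split; first exact: scircuits_opp.
  by rewrite oppE C0E.
by move=> e; rewrite opp_eq0.
Qed.

Lemma ext_restr_orthogonal D' X : D' \in scocircuits N -> X \in scircuits M ->
  orthogonal X (restr D').
Proof.
move=> D'N /ext_scircuit[X' [X'N X'0 <-]].
apply: orthogonal_intro => h; rewrite !ffunE => Xh Dh.
case/orP: (scocircuit_orthogonal D'N X'N) => [/disjointFr/(_ _)|].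
  by move=> /(_ (Some h)); rewrite !inE Xh => /(_ isT); rewrite Dh.
case/andP=> /exists_inP[[a|]]; rewrite inE; last by rewrite X'0.
move=> Xa /eqP Da /exists_inP[[b|]]; rewrite inE; last by rewrite X'0.
by move=> Xb /eqP Db; exists a, b; rewrite !ffunE -oppE.
Qed.

(** [B] is also a basis of [N]. The fundamental cocircuit of [e] in [N], signed like [D] at [e],
    restricts to a signed set orthogonal to the circuits of [M], which is [D] by uniqueness. *)
Lemma ext_scocircuit D : D \in scocircuits M ->
  exists2 D', D' \in scocircuits N & restr D' = D.
Proof.
move=> DM; have [B [e [Bb eB De DB]]] := scocircuit_basis DM.
have [D1 [D1N D1e D1B]] := scocircuit_exists (ext_basis Bb) (imset_f Some eB).
have [D' [D'N D'e D'B]] : exists D', [/\ D' \in scocircuits N, D' (Some e) = D e &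
    forall a, a \in B -> a != e -> D' (Some a) = None].
  have D1B' a : a \in B -> a != e -> D1 (Some a) = None.
    by move=> aB ae; apply: D1B; rewrite ?imset_f.
  case D_e: (D e) De => [[]|] // _; first by exists D1.
  exists (opp D1); split; first exact: scocircuits_opp.
    by rewrite oppE D1e.
  by move=> a aB ae; rewrite oppE D1B'.
exists D' => //; apply: (orthogonal_unique Bb eB).
- by move=> X; apply: ext_restr_orthogonal.
- by move=> X; apply: scocircuit_orthogonal.
- by move=> a aB ae; rewrite ffunE D'B.
- by [].
- by rewrite ffunE.
- by rewrite ffunE D'e.
Qed.

Lemma ext_signature D : D \in scocircuits M -> exists D',
  [/\ D' \in scocircuits N, restr D' = D & extension_signature N D = D' None].
Proof.
move=> DM; rewrite /extension_signature; case: pickP => [D' /andP[D'N /eqP D'D]|noD'].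
  by exists D'.
by have [D' D'N D'D] := ext_scocircuit DM; have := noD' D'; rewrite D'N D'D eqxx.
Qed.

(** The cocircuit [D'] of [N] over [D] meets [C] only at [e] and [None]. As [C] is negative at
    [None], [D'] is positive there exactly when [D] and [C] agree at [e]. *)
Lemma ext_signature_value B e C D : e \in B ->
  C \in scircuits N -> C None = Neg -> (forall x, (C (Some x) != None) = (x \in B)) ->
  D \in scocircuits M -> D e != None -> (forall a, a \in B -> a != e -> D a = None) ->
  extension_signature N D = Some (D e == C (Some e)).
Proof.
move=> eB CN C0 CB DM De DB; have [D' [D'N D'D ->]] := ext_signature DM.
have D'E a : D' (Some a) = D a by rewrite -D'D ffunE.
have [] := orthogonal_pair (a := Some e) (b := None) (scocircuit_orthogonal D'N CN).
- move=> [h|] // he _; rewrite CB D'E => hB; apply: DB => //.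
- by rewrite CB.
- by rewrite D'E.
move=> _; rewrite D'E C0 => D'0; rewrite [D e == _]eq_sym => ->.
by case: (D' None) D'0 => [[]|].
Qed.

Lemma ext_signature_opp D : D \in scocircuits M ->
  extension_signature N D != None /\
  extension_signature N (opp D) = omap negb (extension_signature N D).
Proof.
move=> DM; have [B [e [Bb eB De DB]]] := scocircuit_basis DM.
have [C [CN C0 CB]] := ext_circuit Bb.
rewrite (ext_signature_value eB CN C0 CB DM De DB).
rewrite (ext_signature_value eB CN C0 CB (scocircuits_opp DM)) ?opp_eq0 //; last first.
  by move=> a aB ae; rewrite oppE DB.
have := CB e; rewrite eB oppE; split=> //.
by case: (D e) (C (Some e)) De H => [[]|] [[]|].
Qed.

End Extension.

Section Lifting.
Variables (E : finType) (M : oriented_matroid E) (N : oriented_matroid (option E)).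
Hypothesis liftN : generic_lifting M N.
Implicit Types (B : {set E}) (e : E).

Lemma lift_scircuit X : X \in scircuits M ->
  exists2 X', X' \in scircuits N & restr X' = X.
Proof.
case: liftN => [[_ ->] _]; rewrite !inE => /andP[/andP[_ /imsetP[X' X'N ->]] _].
by exists X'.
Qed.

Lemma lift_restr X' e : X' \in scircuits N -> X' (Some e) != None ->
  exists2 X, X \in scircuits M & supp X \subset supp (restr X').
Proof.
move=> X'N X'e.
have RX' : restr X' \in [set restr X | X in scircuits N] :\ zero_set E.
  rewrite !inE imset_f // andbT; apply: contraNneq X'e => /ffunP/(_ e).
  by rewrite !ffunE => ->.
have [|A minA AX'] := @minset_exists _ (fun A => A \in [set supp Y | Y in
    [set restr X | X in scircuits N] :\ zero_set E]) (supp (restr X')).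
  exact: imset_f.
have /imsetP[X RX AE] := minsetp minA; exists X; rewrite -?AE //.
by case: liftN => [[_ ->] _]; rewrite inE RX -AE.
Qed.

(** If [None] were a loop, a maximum independent set of [N] would avoid it and be independent in
    [M]: the lift of a circuit inside it would contain [None], hence properly contain the loop. But
    the rank of [N] exceeds that of [M]. *)
Lemma lift_nonloop X' : X' \in scircuits N -> exists e, X' (Some e) != None.
Proof.
move=> X'N; apply/existsP; apply: contraT => /existsPn X'0.
have {}X'0 e : X' (Some e) = None by apply/eqP; rewrite -[_ == _]negbK X'0.
have [I [_ indI]] := rank_witness N [set: option E].
case: (liftN) => [[-> _] _] cardI.
have nI : None \notin I.
  apply: contraL indI => I0; apply/indepPn; exists X' => //.
  by apply/subsetP=> -[e|//]; rewrite inE X'0.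
pose J := Some @^-1: I.
have JI : Some @: J = I.
  apply/setP=> -[e|]; first by rewrite mem_imset ?inE //; exact: Some_inj.
  by rewrite (negPf nI); apply/imsetP => -[].
have indJ : indep M J.
  apply/indepP=> X XM; apply/negP=> /subsetP YJ.
  have [Y YN YX] := lift_scircuit XM; rewrite -YX in YJ.
  have Y0 : Y None != None.
    apply: contraL indI => /eqP Y0; apply/indepPn; exists Y => //.
    apply/subsetP=> -[e|]; rewrite inE ?Y0 // => Ye.
    by have := YJ e; rewrite !inE ffunE; apply.
  have/(scircuits_sub X'N YN)/setP sXY : supp X' \subset supp Y.
    by apply/subsetP=> -[e|]; rewrite !inE ?X'0.
  have [e] := scircuits_neq0 XM; have := sXY (Some e).
  by rewrite -YX ffunE !inE X'0 => <-.
have := indep_rank indJ; rewrite -(card_imset _ (@Some_inj _)) JI cardI.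
by rewrite ltnn.
Qed.

Lemma lift_basis B : B \in bases M -> None |: Some @: B \in bases N.
Proof.
move=> Bb; apply: basis_intro => [|[e|]]; last by rewrite !inE.
  apply/indepP=> X' X'N; apply/negP=> /subsetP sX'.
  have [e X'e] := lift_nonloop X'N; have [X XM sX] := lift_restr X'N X'e.
  move/basis_indep/indepP/(_ X XM)/negP: Bb; apply; apply: subset_trans sX _.
  apply/subsetP=> h; rewrite inE ffunE => X'h.
  have := sX' (Some h); rewrite !inE X'h => /(_ isT); rewrite mem_imset //.
  exact: Some_inj.
rewrite !inE /= mem_imset => [eB|]; last exact: Some_inj.
have [X [/lift_scircuit[X' X'N <-] _ /subsetP sX]] := basis_circuit Bb eB.
exists X' => //; apply/subsetP=> -[h|]; rewrite !inE ?orbT // => X'h.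
have := sX h; rewrite !inE ffunE X'h => /(_ isT).
by rewrite mem_imset //; exact: Some_inj.
Qed.

(** Up to sign this is the fundamental cocircuit of [None] for the basis [B] plus [None]. That it is
    nonzero off [B] comes out of [lift_signature_value]. *)
Lemma lift_cocircuit B : B \in bases M -> exists D,
  [/\ D \in scocircuits N, D None = Neg & forall e, e \in B -> D (Some e) = None].
Proof.
move=> /lift_basis Nb; have [D [DN D0 DB]] := scocircuit_exists Nb (setU11 _ _).
exists (opp D); split; first exact: scocircuits_opp.
  by rewrite oppE D0.
by move=> e eB; rewrite oppE DB // !inE imset_f.
Qed.

Lemma lift_signature X : X \in scircuits M -> exists X',
  [/\ X' \in scircuits N, restr X' = X & lifting_signature N X = X' None].
Proof.
move=> XM; rewrite /lifting_signature; case: pickP => [X' /andP[X'N /eqP X'X]|noX'].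
  by exists X'.
by have [X' X'N X'X] := lift_scircuit XM; have := noX' X'; rewrite X'N X'X eqxx.
Qed.

Lemma lift_signature_value B e D X :
  D \in scocircuits N -> D None = Neg -> (forall x, x \in B -> D (Some x) = None) ->
  X \in scircuits M -> X e != None -> supp X \subset e |: B ->
  D (Some e) != None /\ lifting_signature N X = Some (X e == D (Some e)).
Proof.
move=> DN D0 DB XM Xe /subsetP sX; have [X' [X'N X'X ->]] := lift_signature XM.
have X'E a : X' (Some a) = X a by rewrite -X'X ffunE.
have XD h : h != e -> X h != None -> D (Some h) = None.
  by move=> he Xh; apply: DB; have := sX h; rewrite !inE Xh (negPf he); apply.
have oXD := scocircuit_orthogonal DN X'N.
(* If [X'] avoided [None], it could meet [D] only at [e], hence by orthogonality nowhere, and would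
   lie in the complement of [D], which is independent by genericity. *)
have X'0 : X' None != None.
  apply/negP=> X'0.
  have De : D (Some e) = None.
    apply/eqP/negPn/negP=> De.
    case: (orthogonal_pair (a := Some e) (b := None) oXD) => //.
    - by move=> [h|] // he _; rewrite X'E; apply: XD.
    - by rewrite X'E.
    - by rewrite X'0.
  have [Dc _] := andP (etrans (esym (in_set _ _)) DN).
  case: liftN => _ /(_ (supp D) Dc); rewrite inE D0 => /(_ isT)/indepP/(_ X' X'N)/negP.
  apply; apply/subsetP=> -[h|]; rewrite !inE ?X'E ?negbK; last by rewrite (eqP X'0).
  by have [->|he Xh] := eqVneq h e; [rewrite De | rewrite XD].
have [] := orthogonal_pair (a := None) (b := Some e) oXD.
- by move=> [h|] // _ he; rewrite X'E; apply: XD.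
- by [].
- by rewrite D0.
rewrite X'E => _ De XE; split=> //.
by rewrite (canRL negbK (esym XE)) D0; case: (X' None) X'0 => [[]|].
Qed.

Lemma circuit_basis X e : X \in scircuits M -> X e != None ->
  exists2 B, B \in bases M & supp X \subset e |: B.
Proof.
move=> XM Xe; have [|B Bb XB] := @indep_basis _ M (supp X :\ e).
  apply/indepP=> Y YM; apply/negP=> sY.
  have/(scircuits_sub YM XM) YX := subset_trans sY (subD1set _ _).
  by move/subsetP/(_ e): sY; rewrite YX !inE Xe eqxx => /(_ isT).
by exists B => //; rewrite -subDset setDE -setDE.
Qed.

Lemma lift_signature_opp X : X \in scircuits M ->
  lifting_signature N X != None /\
  lifting_signature N (opp X) = omap negb (lifting_signature N X).
Proof.
move=> XM; have [e Xe] := scircuits_neq0 XM.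
have [B Bb XB] := circuit_basis XM Xe; have [D [DN D0 DB]] := lift_cocircuit Bb.
have [De ->] := lift_signature_value DN D0 DB XM Xe XB.
have [||_ ->] := lift_signature_value (e := e) DN D0 DB (scircuits_opp XM).
- by rewrite opp_eq0.
- by rewrite supp_opp.
rewrite oppE; split=> //.
by case: (X e) (D (Some e)) Xe De => [[]|] [[]|].
Qed.

End Lifting.

(** * The counting bound *)

Section Counting.
Variables (E : finType) (P Q : {set signed_set E}).
Hypothesis orthPQ : forall X Y, X \in P -> Y \in Q -> orthogonal X Y.
Implicit Types (S T : {set E}) (X Y : signed_set E) (e : E).

(* A pair [S, T] encodes a partial orientation: an element of [S] is positive
   iff it is in [T], and an element outside [S] is contracted if it is in [T]
   and deleted otherwise.  Circuits ([c = true]) must avoid deleted elements,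
   cocircuits ([c = false]) must avoid contracted ones. *)
Definition fits (c : bool) S T X :=
  [forall e in supp X, if e \in S then X e == Some (e \in T) else (e \in T) == c].

Definition good S T :=
  [forall X in P, ~~ fits true S T X] && [forall Y in Q, ~~ fits false S T Y].

Lemma fits_add c S T T' X e : fits c S T X ->
  (forall x, x != e -> (x \in T') = (x \in T)) ->
  (X e != None -> X e = Some (e \in T')) -> fits c (e |: S) T' X.
Proof.
move=> /forall_inP fX TT' Xe; apply/forall_inP=> x Xx; rewrite !inE.
have [xe|xe] /= := eqVneq x e; first by rewrite xe in Xx *; rewrite inE in Xx; rewrite Xe.
by rewrite TT' // fX.
Qed.

(** Let [X] and [Y] be the two obstructions. Neither fits once [e] is oriented by [T], so both have
    the opposite sign at [e] and agree there. On [S] both follow the orientation, and they share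
    nothing else, since circuits avoid deleted elements and cocircuits avoid contracted ones. This
    contradicts orthogonality. *)
Lemma good_separated S T T1 T2 e : e \notin S -> good (e |: S) T ->
  (forall x, x != e -> (x \in T1) = (x \in T)) ->
  (forall x, x != e -> (x \in T2) = (x \in T)) ->
  ~~ [forall X in P, ~~ fits true S T1 X] ->
  ~~ [forall Y in Q, ~~ fits false S T2 Y] -> False.
Proof.
move=> eS /andP[/forall_inP goodP /forall_inP goodQ] TT1 TT2.
case/forall_inPn=> X XP /negPn fX /forall_inPn[Y YQ /negPn fY].
have Xe : X e != None /\ X e != Some (e \in T).
  apply/andP; rewrite -negb_or; apply: contra (goodP X XP) => Xe.
  apply: (fits_add fX) => [x xe|]; first by rewrite TT1.
  by case/orP: Xe => /eqP ->.
have Ye : Y e != None /\ Y e != Some (e \in T).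
  apply/andP; rewrite -negb_or; apply: contra (goodQ Y YQ) => Ye.
  apply: (fits_add fY) => [x xe|]; first by rewrite TT2.
  by case/orP: Ye => /eqP ->.
have Ye0 : Y e = None; last by rewrite Ye0 in Ye; case: Ye.
apply: (orthogonal_not_agree (orthPQ XP YQ)) Xe.1 => x Xx Yx.
have [->|xe] := eqVneq x e.
  by move: Xe Ye; case: (X e) (Y e) (e \in T) => [[]|] [[]|] [] [] // _ _ [].
move/forall_inP/(_ x): fX; move/forall_inP/(_ x): fY.
rewrite !inE Xx Yx TT1 // TT2 // => /(_ isT) + /(_ isT).
by case: (x \in S) => [/eqP -> /eqP ->|/eqP ->].
Qed.

Definition flip e T := if e \in T then T :\ e else e |: T.

Lemma in_flip e T x : (x \in flip e T) = (x \in T) (+) (x == e).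
Proof.
rewrite /flip; case: ifP => eT; rewrite !inE; have [->|] := eqVneq x e;
  by rewrite ?eT ?addbF.
Qed.

Lemma flipK e : involutive (flip e).
Proof. by move=> T; apply/setP=> x; rewrite !in_flip addbK. Qed.

Lemma flip_off e T x : x != e -> (x \in flip e T) = (x \in T).
Proof. by move=> xe; rewrite in_flip (negPf xe) addbF. Qed.

Lemma fits_skip c S T T' X e : e \notin S -> fits c S T' X -> (e \in T') = ~~ c ->
  (forall x, x != e -> (x \in T) = (x \in T')) -> fits c (e |: S) T X.
Proof.
move=> eS fX eT' TT'; apply: (fits_add fX) => // Xe.
move/forall_inP/(_ e): fX; rewrite inE Xe (negPf eS) eT' => /(_ isT).
by case: (c).
Qed.

(** In [main], [T1] contracts [e] and [T0] deletes it. A cocircuit obstructing the former or a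
    circuit obstructing the latter avoids [e] and would already obstruct [good (e |: S) T]. So if
    both fail, a circuit obstructs [T1] and a cocircuit obstructs [T0], against [good_separated]. *)
Lemma good_or S T e : e \notin S -> good (e |: S) T -> good S T || good S (flip e T).
Proof.
move=> eS gT; have /andP[/forall_inP goodP /forall_inP goodQ] := gT.
have main T1 T0 : e \in T1 -> e \notin T0 ->
    (forall x, x != e -> (x \in T1) = (x \in T)) ->
    (forall x, x != e -> (x \in T0) = (x \in T)) -> good S T1 || good S T0.
  move=> eT1 eT0 TT1 TT0; apply/negPn/negP; rewrite negb_or !negb_and.
  case/andP=> /orP[n1|/forall_inPn[Y YQ /negPn fY]]; last first.
    move/negP: (goodQ Y YQ); case.
    by apply: (fits_skip eS fY) => // x xe; rewrite TT1.
  case/orP=> [/forall_inPn[X XP /negPn fX]|]; last exact: good_separated eS gT TT1 TT0 n1.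
  move/negP: (goodP X XP); case.
  by apply: (fits_skip eS fX); rewrite ?(negPf eT0) // => x xe; rewrite TT0.
have [eT|eT] := boolP (e \in T).
  by apply: main => // [|x]; [rewrite in_flip eT eqxx | exact: flip_off].
rewrite orbC; apply: main => // [|x]; last exact: flip_off.
by rewrite in_flip eqxx (negPf eT).
Qed.

(** Whatever its value at [e], an obstruction for [S] fits one of the two orientations of [e]. *)
Lemma good_both S T e : e \notin S -> good (e |: S) T -> good (e |: S) (flip e T) ->
  good S T.
Proof.
move=> eS /andP[/forall_inP gP /forall_inP gQ] /andP[/forall_inP gP' /forall_inP gQ'].
have fits_cases c X : fits c S T X -> fits c (e |: S) T X \/ fits c (e |: S) (flip e T) X.
  move=> fX; have [Xe|Xe] := eqVneq (X e) (Some (e \in T)).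
    by left; apply: fits_add fX _ _.
  right; apply: (fits_add fX) => [x|]; first exact: flip_off.
  by rewrite in_flip eqxx addbT; case: (X e) (e \in T) Xe => [[]|] [].
apply/andP; split; apply/forall_inP=> X XP; apply/negP=> /fits_cases[fX|fX].
- by move/negP: (gP X XP).
- by move/negP: (gP' X XP).
- by move/negP: (gQ X XP).
- by move/negP: (gQ' X XP).
Qed.

(** [phi] keeps [T] where possible and flips [e] otherwise. It is injective: if a kept set equals a
    flipped one, both orientations of [e] are good, and by [good_both] no flip was due. *)
Lemma card_good_step S e : e \notin S ->
  #|[set T | good (e |: S) T]| <= #|[set T | good S T]|.
Proof.
move=> eS; pose phi T := if good S T then T else flip e T.
rewrite -(card_in_imset (f := phi)) => [|T T'].
  apply: subset_leq_card; apply/subsetP=> _ /imsetP[T + ->]; rewrite !inE => gT.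
  by rewrite /phi; case: ifP (good_or eS gT) => // ->.
rewrite !inE /phi => gT gT'; case: ifP => nT; case: ifP => nT' // E'.
- by move: gT; rewrite E' => /(good_both eS gT'); rewrite nT'.
- by move: gT'; rewrite -E' => /(good_both eS gT); rewrite nT.
- exact: (can_inj (flipK e)).
Qed.

Lemma card_good : #|[set T | good [set: E] T]| <= #|[set T | good set0 T]|.
Proof.
suff main n S : #|S| = n -> #|[set T | good S T]| <= #|[set T | good set0 T]|.
  exact: main erefl.
elim: n S => [|n IHn] S; first by move/cards0_eq ->.
move=> Sn; have [e eS] : exists e, e \in S by apply/set0Pn; rewrite -card_gt0 Sn.
rewrite -(setD1K eS); apply: leq_trans (card_good_step _) (IHn _ _).
  by rewrite !inE eqxx.
by move: Sn; rewrite (cardsD1 e) eS => -[].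
Qed.

End Counting.

(** * The map from bases to orientations *)

Section Beta.
Variables (E : finType) (M : oriented_matroid E) (Nl Ne : oriented_matroid (option E)).
Hypotheses (liftN : generic_lifting M Nl) (extN : generic_extension M Ne).
Implicit Types (B : {set E}) (e : E).
Local Notation sigma := (lifting_signature Nl).
Local Notation sigma_star := (extension_signature Ne).
Local Notation O := (beta M sigma sigma_star).

Lemma signed_circuit_ofP A : A \in circuits M -> exists X,
  [/\ X \in scircuits M, supp X = A, sigma X = Pos & signed_circuit_of M sigma A = X].
Proof.
case/imsetP=> X XM ->; rewrite /signed_circuit_of.
case: pickP => [Y /and3P[YM /eqP YX /eqP sY]|noY]; first by exists Y.
have [sX sX'] := lift_signature_opp liftN XM.
case s: (sigma X) sX => [[]|] // _; first by have := noY X; rewrite XM s !eqxx.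
by have := noY (opp X); rewrite scircuits_opp // supp_opp sX' s !eqxx.
Qed.

Lemma signed_cocircuit_ofP A : A \in cocircuits M -> exists D,
  [/\ D \in scocircuits M, supp D = A, sigma_star D = Pos &
      signed_cocircuit_of M sigma_star A = D].
Proof.
case/cocircuit_signed=> D DM <-; rewrite /signed_cocircuit_of.
case: pickP => [Y /and3P[YM /eqP YD /eqP sY]|noY]; first by exists Y.
have [sD sD'] := ext_signature_opp extN DM.
case s: (sigma_star D) sD => [[]|] // _; first by have := noY D; rewrite DM s !eqxx.
by have := noY (opp D); rewrite scocircuits_opp // supp_opp sD' s !eqxx.
Qed.

(* [O B] is read off one cocircuit of the lifting and one circuit of the
   extension. *)
Lemma beta_out B D e : B \in bases M -> D \in scocircuits Nl -> D None = Neg ->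
  (forall x, x \in B -> D (Some x) = None) -> e \notin B ->
  D (Some e) = O B e /\ O B e != None.
Proof.
move=> Bb DN D0 DB eB; rewrite ffunE (negPf eB) /fund_circuit.
case: pickP => [A /andP[Ac AB]|noA]; last first.
  have [X [XM _ sX]] := basis_circuit Bb eB.
  by have := noA (supp X); rewrite sX imset_f.
have [X [XM XA sX /= ->]] := signed_circuit_ofP Ac; rewrite -XA in AB.
have Xe : X e != None.
  apply/negP=> /eqP Xe; move/basis_indep/indepP/(_ X XM)/negP: Bb; apply.
  apply/subsetP=> h Xh; move/subsetP/(_ h Xh): AB; rewrite !inE.
  by case: eqVneq => // he; rewrite inE he Xe in Xh.
have [_] := lift_signature_value liftN DN D0 DB XM Xe AB.
by rewrite sX => -[/esym/eqP XD]; rewrite -XD.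
Qed.

Lemma beta_in B C e : B \in bases M -> C \in scircuits Ne -> C None = Neg ->
  (forall x, (C (Some x) != None) = (x \in B)) -> e \in B ->
  C (Some e) = O B e /\ O B e != None.
Proof.
move=> Bb CN C0 CB eB; rewrite ffunE eB /fund_cocircuit.
case: pickP => [A /andP[Ac AB]|noA]; last first.
  have [D [DM _ DB]] := scocircuit_exists Bb eB.
  have := noA (supp D); move: DM; rewrite inE => /andP[-> _] /negP[].
  apply/pred0P=> h; rewrite /= !inE; have [_|he] := eqVneq h e; first by rewrite andbF.
  by apply/negP=> /and3P[Dh _ hB]; rewrite DB in Dh.
have [D [DM DA sD /= ->]] := signed_cocircuit_ofP Ac; rewrite -DA in AB Ac.
have DB a : a \in B -> a != e -> D a = None.
  move=> aB ae; apply/eqP/negPn/negP=> Da; move/disjointFr: AB => /(_ a).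
  by rewrite !inE Da aB ae => /(_ isT).
(* Otherwise [D] would miss the basis [B]. *)
have De : D e != None.
  move: Ac; rewrite inE => /minsetp; apply: contraNneq => De.
  apply/exists_inP; exists B => //; apply/subsetP=> h; rewrite !inE => Dh.
  apply: contraNN Dh => hB; have [->|he] := eqVneq h e; first by rewrite De.
  by rewrite DB.
have := ext_signature_value extN eB CN C0 CB DM De DB.
by rewrite sD => -[/esym/eqP DC]; rewrite -DC.
Qed.

Lemma beta_injective : {in bases M &, injective O}.
Proof.
move=> B1 B2 B1b B2b OE; apply/eqP; apply: contraT => B12.
have [C1 [C1N C10 C1B]] := ext_circuit extN B1b.
have [C2 [C2N C20 C2B]] := ext_circuit extN B2b.
have [D1 [D1N D10 D1B]] := lift_cocircuit liftN B1b.
have [D2 [D2N D20 D2B]] := lift_cocircuit liftN B2b.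
have [|||Z [ZN Z0 Zh]] := scircuits_weak_elim (e := None) C1N (scircuits_opp C2N).
- rewrite oppK => C12; case/eqP: B12; apply/setP=> e.
  by rewrite -C1B -C2B C12.
- by rewrite C10.
- by rewrite oppE C10 C20.
have [X' [X'N X'X sX']] := lift_signature liftN (ext_restr extN ZN Z0).
have X'E e : X' (Some e) = Z (Some e).
  by move/ffunP/(_ e): X'X; rewrite !ffunE.
have ZB e : Z (Some e) != None -> Z (Some e) = O B1 e /\ e \in B1 \/
    Z (Some e) = omap negb (O B1 e) /\ e \in B2.
  move=> Ze; have := Ze; case: (Zh _ Ze) => ->; rewrite ?oppE => Ce.
    left; rewrite C1B in Ce; split=> //.
    by case: (beta_in B1b C1N C10 C1B Ce).
  right; rewrite OE.
  have eB : e \in B2 by rewrite -C2B; case: (C2 (Some e)) Ce.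
  by split=> //; case: (beta_in B2b C2N C20 C2B eB) => ->.
have X'0 : X' None != None.
  by rewrite -sX'; case: (lift_signature_opp liftN (ext_restr extN ZN Z0)).
have D1_0 : D1 None != None by rewrite D10.
have D2_0 : D2 None != None by rewrite D20.
(* If [X'] is positive at [None], it disagrees with [D1] at every common element; if negative, it
   agrees with [D2] at every common element. Indeed [ZB] leaves only its second alternative off
   [B1], and only its first off [B2]. *)
case X'0E: (X' None) X'0 => [[]|] // _.
- have: D1 None = None; last by move/eqP; rewrite (negPf D1_0).
  apply: (orthogonal_not_disagree (scocircuit_orthogonal D1N X'N) (h := None)); last first.
    by rewrite X'0E.
  move=> [e|]; last by rewrite X'0E D10.
  rewrite X'E => Ze De; have eB : e \notin B1.
    by apply: contraNN De => eB; rewrite D1B.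
  case: (ZB e Ze) => -[-> eB']; first by rewrite eB' in eB.
  by case: (beta_out B1b D1N D10 D1B eB) => ->.
have: D2 None = None; last by move/eqP; rewrite (negPf D2_0).
apply: (orthogonal_not_agree (scocircuit_orthogonal D2N X'N) (h := None)); last first.
  by rewrite X'0E.
move=> [e|]; last by rewrite X'0E D20.
rewrite X'E => Ze De; have eB : e \notin B2.
  by apply: contraNN De => eB; rewrite D2B.
case: (ZB e Ze) => -[-> eB']; last by rewrite eB' in eB.
by rewrite OE; case: (beta_out B2b D2N D20 D2B eB) => ->.
Qed.

(** The lift of a circuit conformal with [O B] agrees with [D] at every common element of [E]. Were
    it negative at [None], it would agree with [D] there too, against orthogonality. Cocircuits are
    treated dually with [C]. *)
Lemma beta_compatible B :
  B \in bases M -> O B \in compatible_orientations M sigma sigma_star.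
Proof.
move=> Bb; rewrite inE.
have [C [CN C0 CB]] := ext_circuit extN Bb.
have [D [DN D0 DB]] := lift_cocircuit liftN Bb.
apply/and3P; split.
- apply/forallP=> e; have [eB|eB] := boolP (e \in B).
    by case: (beta_in Bb CN C0 CB eB).
  by case: (beta_out Bb DN D0 DB eB).
- apply/forall_inP=> X XM; apply/implyP=> /forall_inP OX.
  have [X' [X'N X'X sX]] := lift_signature liftN XM.
  case: (lift_signature_opp liftN XM); rewrite sX => X'0 _.
  case X'0E: (X' None) X'0 => [[]|] // _.
  have: D None = None; last by rewrite D0.
  apply: (orthogonal_not_agree (scocircuit_orthogonal DN X'N) (h := None)); last first.
    by rewrite X'0E.
  move=> [e|]; last by rewrite X'0E D0.
  move=> X'e De; have eB : e \notin B.
    by apply: contraNN De => eB; rewrite DB.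
  have X'eE : X' (Some e) = X e by rewrite -X'X ffunE.
  rewrite X'eE in X'e *; have := OX e; rewrite inE => /(_ X'e)/eqP <-.
  by case: (beta_out Bb DN D0 DB eB) => ->.
apply/forall_inP=> Y YM; apply/implyP=> /forall_inP OY.
have [Y' [Y'N Y'Y sY]] := ext_signature extN YM.
case: (ext_signature_opp extN YM); rewrite sY => Y'0 _.
case Y'0E: (Y' None) Y'0 => [[]|] // _.
have: Y' None = None; last by rewrite Y'0E.
apply: (orthogonal_not_agree (scocircuit_orthogonal Y'N CN) (h := None)); last first.
  by rewrite C0.
move=> [e|]; last by rewrite C0 Y'0E.
rewrite CB => eB Y'e.
have Y'eE : Y' (Some e) = Y e by rewrite -Y'Y ffunE.
rewrite Y'eE in Y'e *; have := OY e; rewrite inE => /(_ Y'e)/eqP <-.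
by case: (beta_in Bb CN C0 CB eB) => ->.
Qed.

Lemma card_compatible :
  #|compatible_orientations M sigma sigma_star| <= #|bases M|.
Proof.
(* Forbidden circuits and cocircuits: the compatible orientations are those conformal with none of
   them. *)
pose P := [set X in scircuits M | sigma X != Pos].
pose Q := [set D in scocircuits M | sigma_star D != Pos].
have orthPQ X D : X \in P -> D \in Q -> orthogonal X D.
  rewrite !inE => /andP[XM _] /andP[/andP[_ /forall_inP oD] _].
  exact: oD.
(* An orientation is determined by its positive part, which is good for [[set: E]] when the
   orientation is compatible. *)
apply: leq_trans (_ : #|[set T | good P Q [set: E] T]| <= _).
  rewrite -(card_in_imset (f := @pos_part E)); last first.
    move=> O1 O2; rewrite !inE => /and3P[/forallP O1n _ _] /and3P[/forallP O2n _ _].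
    move=> /setP O12; apply/ffunP=> e; move: (O12 e) (O1n e) (O2n e); rewrite !inE.
    by case: (O1 e) (O2 e) => [[]|] [[]|].
  apply: subset_leq_card; apply/subsetP=> _ /imsetP[O0 + ->].
  rewrite !inE => /and3P[/forallP O0n /forall_inP O0s /forall_inP O0t].
  have fitsE c X : fits c [set: E] (pos_part O0) X -> conformal O0 X.
    move=> /forall_inP fX; apply/forall_inP=> e Xe; move: (fX e Xe) (O0n e).
    by rewrite !inE => /eqP ->; case: (O0 e) => [[]|].
  apply/andP; split; apply/forall_inP=> X; rewrite inE => /andP[XM sX].
    by apply: contra sX => /fitsE fX; have := O0s X XM; rewrite fX.
  by apply: contra sX => /fitsE fX; have := O0t X XM; rewrite fX.
(* Every circuit is in [P] and every cocircuit in [Q] up to sign. With nothing oriented, a good [T]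
   thus contains no circuit and its complement no cocircuit, so [T] is a basis. *)
apply: leq_trans (card_good orthPQ) _; apply: subset_leq_card.
apply/subsetP=> T; rewrite inE => /andP[/forall_inP gP /forall_inP gQ].
have indT : indep M T.
  apply/indepP=> X XM; apply/negP=> /subsetP XT.
  have [Y YP YX] : exists2 Y, Y \in P & supp Y = supp X.
    have [sX sX'] := lift_signature_opp liftN XM.
    have [s|s] := eqVneq (sigma X) Pos; last by exists X; rewrite // inE XM s.
    by exists (opp X); rewrite ?supp_opp // inE scircuits_opp // sX' s.
  move/negP: (gP Y YP); apply; apply/forall_inP=> e; rewrite YX => /XT eT.
  by rewrite inE eT.
have [B Bb TB] := indep_basis indT.
suff /eqP-> : T == B by [].
rewrite eqEsubset TB; apply/subsetP=> e eB; apply/negPn/negP=> eT.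
have [D [DM _ DB]] := scocircuit_exists Bb eB.
have [Y YQ YD] : exists2 Y, Y \in Q & supp Y = supp D.
  have [sD sD'] := ext_signature_opp extN DM.
  have [s|s] := eqVneq (sigma_star D) Pos; last by exists D; rewrite // inE DM s.
  by exists (opp D); rewrite ?supp_opp // inE scocircuits_opp // sD' s.
move/negP: (gQ Y YQ); apply; apply/forall_inP=> h; rewrite YD inE => Dh.
rewrite inE eqbF_neg; apply: contraNN Dh => hT; rewrite DB //.
  exact: (subsetP TB).
by apply: contraNneq eT => <-.
Qed.

End Beta.

Theorem theorem1 (E : finType) (M : oriented_matroid E)
    (Mtilde M' : oriented_matroid (option E)) :
  generic_lifting M Mtilde -> generic_extension M M' ->
  let sigma := lifting_signature Mtilde in
  let sigma_star := extension_signature M' in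
  {in bases M &, injective (beta M sigma sigma_star)} /\
  [set beta M sigma sigma_star B | B in bases M]
    = compatible_orientations M sigma sigma_star.
Proof.
move=> liftN extN sigma sigma_star.
have injO := beta_injective liftN extN; split=> //.
apply/eqP; rewrite eqEcard card_in_imset // card_compatible // andbT.
by apply/subsetP=> _ /imsetP[B Bb ->]; apply: beta_compatible.
Qed.
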